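(* Let $k\in\mathbb{N}\cup\{0\}$, $Q\in\mathbb{N}$, and $\varepsilon_0,\dots,\varepsilon_k,\varepsilon'_0,\dots,\varepsilon'_{k+1},\lambda\in\mathbb{R}_+$. Put \[ \varepsilon=\min\Big\{\tfrac{(k+2)\varepsilon_i}{k+1-i}\ \Big|\ i\in\{0,\dots,k\}\Big\},\qquad \varepsilon'=\min\Big\{\tfrac{(k+3)\varepsilon'_i}{k+2-i}\ \Big|\ i\in\{0,\dots,k+1\}\Big\}, \] and suppose \[ \lambda\le \tfrac{1}{d}\min\Big\{\big(\tfrac{\varepsilon}{(k+1)^2 2^{2k+6}}\big)^{2^{k}},\ \big(\tfrac{\varepsilon'}{(k+2)^2 2^{2k+8}}\big)^{2^{k+1}},\ 1\Big\}. \] Let $(X,\mathcal{F})$ be a sheaved strongly connected $d$-complex with $d\ge k+2$ such that: (1) $(X,\mathcal{F})$ is an $i$-local $\varepsilon_i$-coboundary expander in dimension $k$ for all $i\in\{0,\dots,k\}$; (2) $(X,\mathcal{F})$ is an $i$-local $\varepsilon'_i$-coboundary expander in dimension $k+1$ for all $i\in\{0,\dots,k+1\}$; (3) $X$ is a $(d-2)$-local $[-1,\lambda]$-spectral expander; (4) $D(X)\le Q$; (5) $\mathcal{F}(x)\neq 0$ for all $x\in X(k)\cup X(k+1)\cup X(k+2)$. Then: (i) $(X,\mathcal{F})$ $\frac{\varepsilon}{2}$-expands $\big(\frac{\varepsilon}{(k+1)^2 2^{2k+6}}\big)^{2^{k+1}-1}$-small locally minimal $k$-cochains; (ii) $(X,\mathcal{F})$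 $\frac{\varepsilon'}{2}$-expands $\big(\frac{\varepsilon'}{(k+2)^2 2^{2k+8}}\big)^{2^{k+2}-1}$-small locally minimal $(k+1)$-cochains; (iii) $(X,\mathcal{F})$ is an $(\varepsilon_*,\delta_* )$-cosystolic expander in dimension $k$, where $\varepsilon_*=\min\big\{\big(\frac{\varepsilon'}{(k+2)^2 2^{2k+8}}\big)^{2^{k+2}-1},\ \frac{d+1}{(k+1)Q}\binom{d+1}{k+2}^{-1}\big\}$ and $\delta_*=\big(\frac{\varepsilon}{(k+1)^2 2^{2k+6}}\big)^{2^{k+1}-1}$.
   Context: A simplicial complex is a set of finite subsets (faces) of a vertex set closed under subsets, containing the empty face; $X(i)$ is the set of $i$-dimensional faces ($X(-1)=\{\emptyset\}$). A $d$-complex is a finite simplicial complex in which every face is contained in a $d$-face. The link of $z\in X$ is $X_z=\{x\setminus z: z\subseteq x\in X\}$ (a $(d-1-\dim z)$-complex); $X$ is strongly connected if all links $X_z$, $z\in X$ (including $X_\emptyset=X$), are connected. $D(X)$ is the maximum over vertices of the number of $d$-faces containing that vertex. The canonical weight of $x\in X(k)$ is $w(x)=\binom{d+1}{k+1}^{-1}|X(d)|^{-1}\,|\{y\in X(d):y\supseteq x\}|$, $w(A)=\sum_{x\in A}w(x)$. A sheaf $\mathcal{F}$ on $X$ assigns an abelian group $\mathcal{F}(x)$ to each nonempty face and homomorphisms $\mathrm{res}_{y\leftarrow x}:\mathcal{F}(x)\to\mathcal{F}(y)$ for nonempty $x\subsetneq y$, with $\mathrm{res}_{z\leftarrow y}\circ\mathrm{res}_{y\leftarrow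 x}=\mathrm{res}_{z\leftarrow x}$; an augmented sheaf additionally has $\mathcal{F}(\emptyset)$ and maps from it (a sheaf is regarded as augmented with $\mathcal{F}(\emptyset)=0$). For an augmented sheaf, $C^k(X,\mathcal{F})$ is the group of families $(f(x))$ indexed by ordered $k$-faces $x$, $f(x)\in\mathcal{F}(x)$, with $f(\pi x)=\mathrm{sgn}(\pi)f(x)$ under reorderings; $(d_kf)(v_0,\dots,v_{k+1})=\sum_{i}(-1)^i\mathrm{res}_{y\leftarrow y_i}f(y_i)$ where $y_i$ omits $v_i$; $Z^k=\ker d_k$, $B^k=\mathrm{im}\, d_{k-1}$ ($d_{-2}=0$). For a nonempty face $z$, $\mathcal{F}_z$ is the augmented sheaf on $X_z$ with $\mathcal{F}_z(x)=\mathcal{F}(x\cup z)$ and $\mathrm{res}^{\mathcal{F}_z}_{y\leftarrow x}=\mathrm{res}_{y\cup z\leftarrow x\cup z}$. Norm: for $f\in C^k(X,\mathcal{F})$, $\|f\|=w(\{x\in X(k):f(x)\ne0\})$ (computed with the canonical weights of whichever complex is in question); mass $m(k)=w(\{x\in X(k):\mathcal{F}(x)\ne0\})$. $(X,\mathcal{F})$ is an $\varepsilon$-coboundary expander in dimension $k$ if $\|d_kf\|\,m(k)\ge\varepsilon\min_{b\in B^k}\|f+b\|\,m(k+1)$ for all $f\in C^k$; an $(\varepsilon,\delta)$-cosystolic expander in dimension $k$ if $\|d_kf\|\,m(k)\ge\varepsilon\min_{z\in Z^k}\|f+z\|\,m(k+1)$ for all $f\in C^k$ and $\|f\|\ge\delta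 m(k)$ for all $f\in Z^k\setminus B^k$. It is an $i$-local $\varepsilon$-coboundary expander in dimension $k$ if $(X_z,\mathcal{F}_z)$ is an $\varepsilon$-coboundary expander in dimension $k-i-1$ for every $z\in X(i)$. Local minimality: for an ordered face $z$ and $g\in C^{j}(X_z,\mathcal{F}_z)$, $g^z\in C^{j+\dim z+1}(X,\mathcal{F})$ is defined by $g^z(xz)=g(x)$ ($xz$ the concatenation) and $g^z(y)=0$ if $y\not\supseteq z$. $f\in C^k(X,\mathcal{F})$ is locally minimal if for every $z\in X$ of dimension $i\in\{0,\dots,k-1\}$ (vertices ordered arbitrarily) and every $g\in C^{k-i-2}(X_z,\mathcal{F}_z)$, $\|f+d_{k-1}(g^z)\|\ge\|f\|$. $(X,\mathcal{F})$ $\beta$-expands $\alpha$-small locally minimal $k$-cochains if $\|d_kf\|\ge\beta\|f\|$ for every locally minimal $f\in C^k$ with $\|f\|<\alpha$. Spectral expansion: the weighted adjacency operator of $X$ acts on functions $f:X(0)\to\mathbb{R}$ by $(\mathcal{A}f)(x)=\sum_{e\in X(1),e\supseteq x}\frac{w(e)}{2w(x)}f(e\setminus x)$; $X$ is a $[-1,\lambda]$-spectral expander if the spectrum of $\mathcal{A}$ on functions with $\sum_v f(v)=0$ lies in $[-1,\lambda]$; $X$ is a $j$-local $[-1,\lambda]$-spectral expander if every link $X_z$, $z\in X(j)$, is (with its own canonical weights).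
   Formalization: In the definition of spectral expander, the spectrum of A is taken on functions with Σ_v w(v)f(v)=0 instead of Σ_v f(v)=0, since the unweighted space is not A-invariant unless the vertex weights are equal, in which case the two agree. *)

(* Defs.v *)
From HB Require Import structures.
From mathcomp Require Import all_boot all_order all_algebra all_fingroup.
From mathcomp Require Import boolp reals.

Set Implicit Arguments.
Unset Strict Implicit.
Unset Printing Implicit Defensive.

Import Order.TTheory GRing.Theory Num.Theory.
Local Open Scope ring_scope.

(* Indexing convention.  Faces are finite sets of vertices, and everything is
   indexed by the number [n] of vertices of a face rather than by its dimension
   [n - 1], so that dimension -1 (the empty face) is covered by [nat]: the
   i-dimensional faces are [cells X i.+1], and C^k, Z^k, B^k are
   [is_cochain k.+1], [is_cocycle k.+1], [is_coboundary k.+1]. *)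

Section Complexes.
Variable T : finType.
Implicit Types (X : {set {set T}}) (x y z : {set T}).

Definition cells X (n : nat) : {set {set T}} := [set x in X | #|x| == n].

Definition is_dcomplex (d : nat) X : Prop :=
  [/\ set0 \in X,
      forall x y, y \in X -> x \subset y -> x \in X
    & forall x, x \in X -> exists2 y, y \in cells X d.+1 & x \subset y].

(* If X is a d-complex and z is a face, this is a complex of dimension
   d - 1 - dim z = d - #|z|. *)
Definition link X z : {set {set T}} := [set x :\: z | x in X & z \subset x].

Definition adjacent X : rel T := [rel u v | (u != v) && ([set u; v] \in X)].

Definition is_connected X : Prop :=
  forall u v, [set u] \in X -> [set v] \in X -> connect (adjacent X) u v.

(* Connectedness is only meaningful for links of dimension at least 1: a link
   of a (d-1)-face is a discrete set of points, of a d-face it is {set0}. *)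
Definition strongly_connected (d : nat) X : Prop :=
  forall z, z \in X -> (#|z| < d)%N -> is_connected (link X z).

Definition max_degree (d : nat) X : nat :=
  \max_(v : T | [set v] \in X) #|[set y in cells X d.+1 | v \in y]|.

Variable R : realType.

Definition weight (d : nat) X x : R :=
  #|[set y in cells X d.+1 | x \subset y]|%:R
    / ('C(d.+1, #|x|)%:R * #|cells X d.+1|%:R).

Definition set_weight (d : nat) X (A : {set {set T}}) : R :=
  \sum_(x in A) weight d X x.

(* The edges containing the vertex x correspond to the neighbours of x. *)
Definition adjacency (d : nat) X (f : T -> R) (x : T) : R :=
  \sum_(y : T | adjacent X x y)
     weight d X [set x; y] / (2 * weight d X [set x]) * f y.

(* The operator acts on functions on the vertices of X, so the values of f
   elsewhere are irrelevant.  It is self-adjoint for the inner product weighted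
   by [weight], hence its spectrum consists of real eigenvalues, and the
   invariant complement of the constant functions is the space of functions
   whose weighted sum vanishes. *)
Definition spectral_expander (d : nat) X (lambda : R) : Prop :=
  forall (mu : R) (f : T -> R),
    (exists2 v, [set v] \in X & f v != 0) ->
    \sum_(v : T | [set v] \in X) weight d X [set v] * f v = 0 ->
    (forall v, [set v] \in X -> adjacency d X f v = mu * f v) ->
    -1 <= mu <= lambda.

Definition local_spectral_expander (d : nat) X (j : nat) (lambda : R) : Prop :=
  forall z, z \in cells X j.+1 ->
    spectral_expander (d - #|z|) (link X z) lambda.

End Complexes.

(* Augmented sheaves.  Groups at non-faces, and the maps between sets which are
   not a pair x \proper y of faces, are irrelevant. *)
Record augSheaf (T : finType) (X : {set {set T}}) := AugSheaf {
  sections :> {set T} -> zmodType;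
  res : forall x y : {set T}, {additive sections x -> sections y};
  res_comp : forall x y z : {set T}, x \in X -> y \in X -> z \in X ->
    x \proper y -> y \proper z ->
    forall a : sections x, res y z (res x y a) = res x z a
}.
Arguments res {T X} F x y : rename.

Definition nonzero_group (G : zmodType) : Prop := exists a : G, a != 0.

(* A sheaf is an augmented sheaf whose group at the empty face is zero. *)
Definition is_sheaf (T : finType) (X : {set {set T}}) (F : augSheaf X) : Prop :=
  ~ nonzero_group (F set0).

Section LinkSheaf.
Variables (T : finType) (X : {set {set T}}) (F : augSheaf X) (z : {set T}).

Lemma link_setU (x : {set T}) :
  x \in link X z -> x :|: z \in X /\ [disjoint x & z].
Proof.
case/imsetP=> y; rewrite inE => /andP[yX zy] ->; split.
  by rewrite setUC -{1}(setIidPr zy) setID.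
by rewrite disjoints_subset setDE subsetIr.
Qed.

Lemma link_res_comp (x y u : {set T}) :
  x \in link X z -> y \in link X z -> u \in link X z ->
  x \proper y -> y \proper u ->
  forall a : F (x :|: z),
    res F (y :|: z) (u :|: z) (res F (x :|: z) (y :|: z) a)
    = res F (x :|: z) (u :|: z) a.
Proof.
have properU (a b : {set T}) : [disjoint b & z] ->
    a \proper b -> a :|: z \proper b :|: z.
  move=> dbz /properP[ab [v vb va]]; apply/properP; split; first exact: setSU.
  by exists v; rewrite !inE ?vb // negb_or va (disjointFr dbz vb).
move=> /link_setU[xX _] /link_setU[yX dy] /link_setU[uX du] xy yu.
by apply: res_comp => //; apply: properU.
Qed.

Definition link_sheaf : augSheaf (link X z) :=
  AugSheaf (sections := fun x => F (x :|: z))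
    (res := fun x y => res F (x :|: z) (y :|: z)) link_res_comp.

End LinkSheaf.

Section Cochains.
Variable T : finType.
Implicit Types (X : {set {set T}}) (x y z : {set T}).

(* [s] lists the vertices of [x], without repetition. *)
Definition ordering x (s : seq T) : bool := uniq s && ([set v in s] == x).

(* [f x s] is the value, in F(x), of the cochain [f] at the ordered face whose
   underlying face is [x] and whose ordering is [s]; it is required to be 0 when
   [(x, s)] is not an ordered face of the appropriate dimension. *)
Definition cochain X (F : augSheaf X) : Type :=
  forall x : {set T}, seq T -> F x.

Definition is_cochain X (F : augSheaf X) (n : nat) (f : cochain F) : Prop :=
  (forall x (s : seq T),
     ~~ ((x \in cells X n) && ordering x s) -> f x s = 0) /\
  (forall x (t : n.-tuple T) (p : 'S_n),
     f x [tuple tnth t (p i) | i < n] = f x t *~ (-1) ^+ p).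

Definition cochain_eq X (F : augSheaf X) (f g : cochain F) : Prop :=
  forall x (s : seq T), f x s = g x s.

Definition cochain_add X (F : augSheaf X) (f g : cochain F) : cochain F :=
  fun x s => f x s + g x s.

Definition omit (s : seq T) (i : nat) : seq T := take i s ++ drop i.+1 s.

Definition differential X (F : augSheaf X) (f : cochain F) : cochain F :=
  fun y s =>
    if (y \in X) && ordering y s then
      \sum_(i < size s)
        res F (y :\ tnth (in_tuple s) i) y
          (f (y :\ tnth (in_tuple s) i) (omit s i)) *~ (-1) ^+ i
    else 0.

Definition is_cocycle X (F : augSheaf X) (n : nat) (f : cochain F) : Prop :=
  is_cochain n f /\ cochain_eq (differential f) (fun _ _ => 0).

Definition is_coboundary X (F : augSheaf X) (n : nat) (f : cochain F) : Prop :=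
  if n is m.+1 then
    exists2 g : cochain F, is_cochain m g & cochain_eq f (differential g)
  else cochain_eq f (fun _ _ => 0).

Variable R : realType.

(* Whether f(x) is nonzero does not depend on the chosen ordering [enum x]. *)
Definition support X (F : augSheaf X) (n : nat) (f : cochain F) :
    {set {set T}} := [set x in cells X n | f x (enum x) != 0].

(* In what follows d is the dimension of the complex X. *)

Definition norm (d : nat) X (F : augSheaf X) (n : nat) (f : cochain F) : R :=
  set_weight R d X (support n f).

Definition mass (d : nat) X (F : augSheaf X) (n : nat) : R :=
  set_weight R d X [set x in cells X n | `[< nonzero_group (F x) >]].

(* [b] attains the minimum of ||f + b|| over [B]. *)
Definition minimizer (d : nat) X (F : augSheaf X) (n : nat)
    (B : cochain F -> Prop) (f b : cochain F) : Prop :=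
  B b /\ forall b', B b' ->
    norm d n (cochain_add f b) <= norm d n (cochain_add f b').

Definition expands_modulo (d : nat) X (F : augSheaf X) (n : nat)
    (B : cochain F -> Prop) (eps : R) : Prop :=
  forall f : cochain F, is_cochain n f ->
    exists2 b : cochain F, minimizer d n B f b &
      eps * norm d n (cochain_add f b) * mass d F n.+1
        <= norm d n.+1 (differential f) * mass d F n.

Definition coboundary_expander (d : nat) X (F : augSheaf X) (n : nat)
    (eps : R) : Prop :=
  expands_modulo d n (@is_coboundary X F n) eps.

Definition cosystolic_expander (d : nat) X (F : augSheaf X) (n : nat)
    (eps delta : R) : Prop :=
  expands_modulo d n (@is_cocycle X F n) eps /\
  (forall f : cochain F, is_cocycle n f -> ~ is_coboundary n f ->
     delta * mass d F n <= norm d n f).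

Definition local_coboundary_expander (d : nat) X (F : augSheaf X)
    (i n : nat) (eps : R) : Prop :=
  forall z, z \in cells X i.+1 ->
    coboundary_expander (d - #|z|) (link_sheaf F z) (n - i.+1) eps.

(* [h] is the cochain g^z, where g is a cochain of (X_z, F_z) on faces with m
   vertices and z is ordered by [s].  This determines [h] because cochains are
   alternating. *)
Definition is_extension X (F : augSheaf X) z (s : seq T) (m : nat)
    (g : cochain (link_sheaf F z)) (h : cochain F) : Prop :=
  [/\ is_cochain (m + #|z|) h,
      forall x (t : seq T), x \in cells (link X z) m -> ordering x t ->
        h (x :|: z) (t ++ s) = g x t
    & forall y (t : seq T), ~~ (z \subset y) -> h y t = 0].

Definition locally_minimal (d : nat) X (F : augSheaf X) (n : nat)
    (f : cochain F) : Prop :=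
  forall z (s : seq T), z \in X -> (0 < #|z| < n)%N -> ordering z s ->
  forall (g : cochain (link_sheaf F z)) (h : cochain F),
    is_cochain (n.-1 - #|z|) g -> is_extension s (n.-1 - #|z|) g h ->
    norm d n f <= norm d n (cochain_add f (differential h)).

(* (X, F) beta-expands alpha-small locally minimal cochains. *)
Definition expands_small (d : nat) X (F : augSheaf X) (n : nat)
    (beta alpha : R) : Prop :=
  forall f : cochain F, is_cochain n f -> locally_minimal d n f ->
    norm d n f < alpha -> beta * norm d n f <= norm d n.+1 (differential f).

End Cochains.

Definition ord_min (R : realType) (n : nat) (e : 'I_n.+1 -> R) : R :=
  \big[Num.min/e ord0]_(i < n.+1) e i.

(* Main.v *)
Require Import Defs.
From mathcomp Require Import all_boot all_order all_algebra all_fingroup.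
From mathcomp Require classical_sets.
From mathcomp Require Import boolp reals.
From mathcomp Require Import ring lra zify.

Set Implicit Arguments.
Unset Strict Implicit.
Unset Printing Implicit Defensive.

Import Order.TTheory GRing.Theory Num.Theory.
Local Open Scope ring_scope.

(* Everything is expressed through the weight w, using that
   \sum_(v \notin x) w (x + v) = (|x| + 1) w x.
   By trickling down, all links are spectral expanders up to a factor d.

   Let f be locally minimal and small, with support S on faces with n vertices.
   Call the faces of S fat and, going down one vertex at a time, call a face fat
   if it is contained in a large proportion of fat faces with one more vertex;
   as f is small, the empty face is not fat.  By the mixing lemma few faces
   y with n + 1 vertices are bad, i.e., contain two fat faces meeting in a face of
   codimension 1 which is not fat.  Every x in S is linked by a chain of fat faces
   (a ladder) to a minimal fat face; in a face y which is not bad all facets from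
   S reach the same minimal faces.  Splitting S according to these minimal faces z
   and applying the coboundary expansion of the link of z to each piece (which is
   minimal there, being a restriction of a minimal cochain) bounds the norm of df
   from below up to the weight of the bad faces.

   Cosystolic expansion follows by correcting df greedily to a locally minimal
   cochain, which vanishes by small expansion one dimension higher. *)

(** * Weighted graphs *)

(** No expansion is assumed at the empty face, that is, for [X] itself. Hence every face of the
    support must be attached to a nonempty face, and the smallness of f is spent on keeping the
    empty face from being fat. The exponents 2^j come from a balance. Let t_j be the proportion that
    makes a face with n - j - 1 vertices fat. By Markov's inequality, the weight of the fat faces
    with n - j vertices is at most |f| / (t_0 ... t_(j-1)). By mixing, in the link of a face with n
    - j - 1 vertices that is not fat, at most a proportion t_j + lambda of the edges at fat vertices
    lead to fat vertices. The product is of order eta |f| at every level if lambda <= t_j = eta t_0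
    ... t_(j-1), which means t_j = eta^(2^j). Thus keeping the empty face from being fat costs the
    exponent 2^n - 1, and lambda must be at most eta^(2^(n-1)). The denominator n^2 2^(2n+4) of eta
    makes the loss on bad faces at most half of the main term. *)

Section Rayleigh.
Import classical_sets.
Variables (R : realType) (n : nat).
Implicit Types (S : 'M[R]_n) (D x y : 'rV[R]_n).

Definition qform S x : R := \sum_i \sum_j S i j * x 0 i * x 0 j.

Lemma qformE S x : qform S x = (x *m S *m x^T) 0 0.
Proof.
rewrite /qform !mxE exchange_big /=; apply: eq_bigr => j _.
by rewrite !mxE mulr_suml; apply: eq_bigr => i _; rewrite mulrAC mulrC mulrA.
Qed.

Lemma qform_diag D x : qform (diag_mx D) x = \sum_i D 0 i * x 0 i ^+ 2.
Proof.
rewrite /qform; apply: eq_bigr => i _.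
rewrite (bigD1 i) //= big1 => [|j ji]; last by rewrite mxE eq_sym (negPf ji) !mul0r.
by rewrite mxE eqxx addr0 expr2 mulrA.
Qed.

Section Diag.
Variable D : 'rV[R]_n.
Hypothesis Dpos : forall i, 0 < D 0 i.

Lemma qform_diag_gt0 x : x != 0 -> 0 < qform (diag_mx D) x.
Proof.
move=> x0; rewrite qform_diag.
have [i xi] : exists i, x 0 i != 0.
  apply/existsP; apply: contraR x0; rewrite negb_exists => /forallP x0.
  by apply/eqP/rowP => i; rewrite mxE; apply/eqP; move: (x0 i); rewrite negbK.
rewrite (bigD1 i) //= ltr_wpDr //; first by apply: sumr_ge0 => j _; rewrite mulr_ge0 ?sqr_ge0 // ltW.
by rewrite mulr_gt0 // exprn_even_gt0.
Qed.

(** Makes the Rayleigh quotient bounded above: [|x_i x_j| <= x_i^2 + x_j^2], and the diagonal form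
    controls each square up to [(D 0 i)^-1]. The summand 1 keeps [C] positive, since [C^-1] will
    serve as a step size. *)
Lemma qform_le_diag S : exists2 C, 0 < C & forall x, qform S x <= C * qform (diag_mx D) x.
Proof.
exists (1 + \sum_i \sum_j `|S i j| * ((D 0 i)^-1 + (D 0 j)^-1)).
  rewrite ltr_pwDl ?ltr01 //; apply: sumr_ge0 => i _; apply: sumr_ge0 => j _.
  by rewrite mulr_ge0 // addr_ge0 // invr_ge0 ltW.
move=> x; set q := qform (diag_mx D) x.
have xq i : x 0 i ^+ 2 <= (D 0 i)^-1 * q.
  rewrite mulrC ler_pdivlMr // mulrC /q qform_diag (bigD1 i) //= lerDl.
  by apply: sumr_ge0 => j _; rewrite mulr_ge0 ?sqr_ge0 // ltW.
have q0 : 0 <= q.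
  by rewrite /q qform_diag; apply: sumr_ge0 => j _; rewrite mulr_ge0 ?sqr_ge0 // ltW.
rewrite mulrDl mul1r -[leLHS]add0r lerD // mulr_suml /qform; apply: ler_sum => i _.
rewrite mulr_suml; apply: ler_sum => j _.
rewrite -mulrA (le_trans (ler_norm _)) // normrM -mulrA ler_wpM2l // mulrDl.
apply: (@le_trans _ _ (x 0 i ^+ 2 + x 0 j ^+ 2)); last exact: lerD.
rewrite ler_norml; apply/andP; split.
  have := sqr_ge0 (x 0 i + x 0 j); have := sqr_ge0 (x 0 i); have := sqr_ge0 (x 0 j); nra.
have := sqr_ge0 (x 0 i - x 0 j); have := sqr_ge0 (x 0 i); have := sqr_ge0 (x 0 j); nra.
Qed.

(* The supremum M of the Rayleigh quotient is an eigenvalue: the form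
   B = M D - S is nonnegative, and if B were invertible, evaluating it at
   x - t x D B^-1 for a small t would give B >= t D, so that M - t would be an
   upper bound as well. *)
Lemma exists_eigen_gt S (a : R) x0 : S^T = S ->
  a * qform (diag_mx D) x0 < qform S x0 ->
  exists mu, exists2 x : 'rV[R]_n, a < mu /\ x != 0 & x *m S = mu *: (x *m diag_mx D).
Proof.
move=> Ssym ax0.
have subE (P Q : 'M[R]_1) : (P - Q) 0 0 = P 0 0 - Q 0 0 by rewrite !mxE.
have scaleE c (P : 'M[R]_1) : (c *: P) 0 0 = c * P 0 0 by rewrite mxE.
have x0n : x0 != 0.
  apply: contraTneq ax0 => ->; rewrite !qformE !mul0mx mxE.
  by rewrite mulr0 ltxx.
pose E : set R := fun t => exists2 x, x != 0 & t = qform S x / qform (diag_mx D) x.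
have supE : has_sup E.
  split; first by exists (qform S x0 / qform (diag_mx D) x0); exists x0.
  have [C C0 HC] := qform_le_diag S; exists C => _ [x xn ->].
  by rewrite ler_pdivrMr ?qform_diag_gt0.
pose M := sup E; pose B := M *: diag_mx D - S.
have leM x : qform S x <= M * qform (diag_mx D) x.
  have [->|xn] := eqVneq x 0; first by rewrite !qformE !mul0mx mxE mulr0.
  rewrite -ler_pdivrMr ?qform_diag_gt0 //; apply: (ub_le_sup (proj2 supE)).
  by exists x.
have aM : a < M.
  have := lt_le_trans ax0 (leM x0).
  by rewrite ltr_pM2r ?qform_diag_gt0.
have qB x : qform B x = M * qform (diag_mx D) x - qform S x.
  by rewrite !qformE /B mulmxBr mulmxBl -scalemxAr -scalemxAl subE scaleE.
have Bsym : B^T = B by rewrite /B linearB linearZ /= tr_diag_mx Ssym.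
have BE : B = M *: diag_mx D - S by [].
clearbody B; have [uB|nB] := boolP (B \in unitmx); last first.
  have [x xn xB] : exists2 x : 'rV[R]_n, x != 0 & x *m B = 0.
    have: kermx B != 0 by rewrite kermx_eq0 row_free_unit.
    case/rowV0Pn => x /sub_kermxP xB xn; by exists x.
  exists M, x => //; apply/eqP; rewrite -subr_eq0 -oppr_eq0 opprB.
  by rewrite scalemxAr -mulmxBr -BE xB.
exfalso; pose V := invmx B.
have Vsym : V^T = V by rewrite /V trmx_inv Bsym.
pose DD := diag_mx D.
have [C C0 HC] := qform_le_diag (DD *m V *m DD).
(* With [t = C^-1], evaluating [B] at [x - t x D V] gives [B(x) - 2 t D(x) + t^2 (D V D)(x) >= 0];
   the choice of [C] bounds the last term by [t D(x)], which leaves [B(x) >= t D(x)]. *)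
have key x : qform DD x <= C * qform B x.
  have := leM (x - C^-1 *: (x *m DD *m V)).
  have trE : (x - C^-1 *: (x *m DD *m V))^T = x^T - C^-1 *: (V *m (DD *m x^T)).
    by rewrite linearB linearZ /= !trmx_mul Vsym tr_diag_mx.
  rewrite -subr_ge0 -qB qformE trE.
  have h1 : x *m B *m (V *m (DD *m x^T)) = x *m DD *m x^T.
    by rewrite -!mulmxA (mulmxA B) mulmxV // mul1mx.
  have h2 : x *m DD *m V *m B *m x^T = x *m DD *m x^T.
    by rewrite -!mulmxA (mulmxA V) mulVmx // mul1mx.
  have h3 : x *m DD *m V *m B *m (V *m (DD *m x^T)) = x *m (DD *m V *m DD) *m x^T.
    by rewrite -!mulmxA (mulmxA B) mulmxV // mul1mx !mulmxA.
  rewrite !mulmxBl !mulmxBr -!scalemxAl -!scalemxAr.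
  rewrite h1 h2 h3 => H.
  have {H} : 0 <= qform B x - C^-1 * qform DD x
     - (C^-1 * qform DD x - C^-1 * (C^-1 * qform (DD *m V *m DD) x)).
    by move: H; rewrite !qformE !subE !scaleE.
  have := HC x; rewrite -/DD; move: (qform (DD *m V *m DD) x) (qform DD x) (qform B x) => p q r pq.
  have Ci : C^-1 * C = 1 by rewrite mulVf ?gt_eqF.
  have : C^-1 * p <= q by rewrite mulrC ler_pdivrMr // mulrC.
  have ci : 0 < C^-1 by rewrite invr_gt0.
  move: Ci ci pq; move: C^-1 => c Ci ci pq cp H.
  have : c * (c * p) <= c * q by rewrite ler_pM2l.
  move=> H2; have {}H : c * q <= r by lra.
  have : C * (c * q) <= C * r by rewrite ler_pM2l.
  by rewrite mulrA [C * c]mulrC Ci mul1r.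
suff : M <= M - C^-1 by apply/negP; rewrite -ltNge ltrBlDr ltrDl invr_gt0.
apply: ge_sup; first by case: supE.
move=> _ [x xn ->]; rewrite ler_pdivrMr ?qform_diag_gt0 // mulrBl.
have := key x; rewrite qB -/DD => H.
have : C^-1 * qform DD x <= M * qform DD x - qform S x.
  by rewrite mulrC ler_pdivrMr // mulrC.
lra.
Qed.

End Diag.
End Rayleigh.

Section WeightedGraphs.
Variables (R : realType) (T : finType).
Implicit Types (K : T -> T -> R) (f : T -> R) (lambda : R).

Definition degree K v : R := \sum_u K v u.

Definition energy K f : R := \sum_u \sum_v K u v * f u * f v.

(** Bounds the second largest eigenvalue of the random walk on [K], as an inequality of quadratic
    forms: in this shape it can be tested on indicator functions and summed over links. *)
Definition spectral_gap K lambda : Prop :=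
  forall f, \sum_v degree K v * f v = 0 ->
    energy K f <= lambda * \sum_v degree K v * f v ^+ 2.

Definition graph_connected K : Prop :=
  forall f, (forall u v, 0 < K u v -> f u = f v) ->
    exists c, forall v, 0 < degree K v -> f v = c.

Section OneGraph.
Variable K : T -> T -> R.
Hypothesis Ksym : forall u v, K u v = K v u.
Hypothesis K_ge0 : forall u v, 0 <= K u v.

Lemma degree_ge0 v : 0 <= degree K v.
Proof. by apply: sumr_ge0. Qed.

Lemma le_degree u v : K u v <= degree K u.
Proof. by rewrite /degree (bigD1 v) //= lerDl; apply: sumr_ge0. Qed.

Lemma degree_eq0 u v : degree K u = 0 -> K u v = 0.
Proof. by move=> u0; apply/eqP; rewrite eq_le K_ge0 -u0 le_degree. Qed.

Lemma sum_degree_eq0 f : \sum_v degree K v = 0 -> \sum_v degree K v * f v = 0.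
Proof.
move=> h; have d0 : forall v, degree K v = 0.
  move=> v; apply/eqP; rewrite eq_le degree_ge0 andbT -h (bigD1 v) //= lerDl.
  by apply: sumr_ge0 => u _; apply: degree_ge0.
by rewrite big1 // => v _; rewrite d0 mul0r.
Qed.

(** Variational principle: a function violating the quadratic inequality yields an eigenfunction
    above [lambda], which is what the definition of a spectral expander excludes. *)
Lemma spectral_gap_eigen lambda : 0 <= lambda ->
  (forall mu f, (exists2 v, degree K v != 0 & f v != 0) ->
    \sum_v degree K v * f v = 0 ->
    (forall u, \sum_v K u v * f v = mu * degree K u * f u) -> mu <= lambda) ->
  spectral_gap K lambda.
Proof.
move=> l0 Heig f0 f00; rewrite leNgt; apply/negP => lt_f.
pose f v := f0 v * (degree K v != 0)%:R.
have fE v : degree K v * f v = degree K v * f0 v.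
  by rewrite /f; have [->|] := eqVneq (degree K v) 0; rewrite ?mul0r //= mulr1.
have fE2 u v : K u v * f u * f v = K u v * f0 u * f0 v.
  rewrite /f; have [u0|] := eqVneq (degree K u) 0.
    by rewrite (degree_eq0 v u0) !mul0r.
  have [v0|] := eqVneq (degree K v) 0; last by rewrite /= !mulr1.
  by rewrite Ksym (degree_eq0 u v0) !mul0r.
pose r := \sum_v degree K v.
pose N := #|T|.
pose ev : 'I_N -> T := enum_val.
have evK u : ev (enum_rank u) = u by exact: enum_rankK.
have Kev i : enum_rank (ev i) = i by exact: enum_valK.
(* Subtracting this rank one form moves the eigenvalue of the constants from 1 to 0, so that an
   eigenvector above [lambda >= 0] is orthogonal to them. Below, [D] is padded by 1 at isolated
   vertices to make it positive definite. *)
pose S : 'M[R]_N := \matrix_(i, j) (K (ev i) (ev j) - degree K (ev i) * degree K (ev j) / r).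
pose D : 'rV[R]_N := \row_i (degree K (ev i) + (degree K (ev i) == 0)%:R).
pose x0 : 'rV[R]_N := \row_i f (ev i).
have sumE (G : T -> R) : \sum_(i < N) G (ev i) = \sum_v G v.
  by rewrite -(big_enum_val G).
have Ssym : S^T = S by apply/matrixP => i j; rewrite !mxE Ksym [degree K (ev j) * _]mulrC.
have Dpos i : 0 < D 0 i.
  rewrite mxE; have [->|n0] := eqVneq (degree K (ev i)) 0; first by rewrite add0r.
  by rewrite addr0 lt_neqAle eq_sym n0 degree_ge0.
have qS : qform S x0 = energy K f0.
  rewrite /qform /energy.
  transitivity (\sum_u \sum_v (K u v * f0 u * f0 v - r^-1 * (degree K u * f0 u) * (degree K v * f0 v))).
    rewrite -sumE; apply: eq_bigr => i _; rewrite -sumE; apply: eq_bigr => j _.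
    rewrite !mxE -fE2 -!fE; ring.
  under eq_bigr do rewrite sumrB -mulr_sumr f00 mulr0 subr0.
  by [].
have qD : qform (diag_mx D) x0 = \sum_v degree K v * f0 v ^+ 2.
  rewrite qform_diag -sumE; apply: eq_bigr => i _; rewrite !mxE /f.
  by have [->|] := eqVneq (degree K (ev i)) 0; rewrite /= ?mulr1 ?addr0 // mulr0 expr0n /= mulr0 mul0r.
have [] := @exists_eigen_gt R N D Dpos S lambda x0 Ssym; first by rewrite qS qD.
move=> mu [x [mul xn] xS]; have mu0 : 0 < mu by apply: le_lt_trans mul.
pose g v := x 0 (enum_rank v).
have gE i : x 0 i = g (ev i) by rewrite /g Kev.
have Sg u : \sum_v K u v * g v - degree K u / r * \sum_v degree K v * g v
   = mu * ((degree K u + (degree K u == 0)%:R) * g u).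
  have /matrixP/(_ 0 (enum_rank u)) := xS.
  rewrite [RHS]mxE [X in _ = _ * X]mxE (bigD1 (enum_rank u)) //= big1 ?addr0 => [|j ju]; last first.
    by rewrite mxE (negPf ju) mulr0.
  rewrite !mxE eqxx mulr1n !evK => H.
  rewrite -/(g u) in H; rewrite [X in mu * X]mulrC -H; rewrite mulr_sumr -sumrB -sumE.
  apply: eq_bigr => j _; rewrite mxE evK /g Ksym Kev; ring.
have g0 u : degree K u = 0 -> g u = 0.
  move=> u0; have := Sg u; rewrite u0 eqxx mul0r mul0r add0r mul1r subr0 big1 => [|v _].
    by move/esym/eqP; rewrite mulf_eq0 (gt_eqF mu0) => /eqP.
  by rewrite (degree_eq0 v u0) mul0r.
have {}Sg u : \sum_v K u v * g v - degree K u / r * \sum_v degree K v * g v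
   = mu * degree K u * g u.
  by rewrite Sg; have [/g0->|] := eqVneq (degree K u) 0; rewrite ?mulr0 // addr0 mulrA.
have gbar : \sum_v degree K v * g v = 0.
  have [r0|rn0] := eqVneq r 0; first exact: sum_degree_eq0.
  have : \sum_u mu * degree K u * g u = 0.
    rewrite -(eq_bigr _ (fun u _ => Sg u)) sumrB -mulr_suml -mulr_suml -/r divff // mul1r.
    rewrite exchange_big /=; under eq_bigr do rewrite -mulr_suml.
    apply/eqP; rewrite subr_eq0; apply/eqP; apply: eq_bigr => v _; congr (_ * _).
    by apply: eq_bigr => u _; rewrite Ksym.
  under eq_bigr do rewrite -mulrA.
  by rewrite -mulr_sumr => /eqP; rewrite mulf_eq0 (gt_eqF mu0) => /eqP.
have : mu <= lambda; last by rewrite leNgt mul.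
apply: (Heig mu g) => // [|u]; last by rewrite -Sg gbar mulr0 subr0.
have [i xi] : exists i, x 0 i != 0.
  apply/existsP; apply: contraR xn; rewrite negb_exists => /forallP xn.
  by apply/eqP/rowP => i; rewrite mxE; apply/eqP; move: (xn i); rewrite negbK.
exists (ev i); last by rewrite -gE.
by apply: contraNN xi; rewrite gE => /eqP/g0->.
Qed.

Lemma spectral_gap_le lambda lambda' :
  lambda <= lambda' -> spectral_gap K lambda -> spectral_gap K lambda'.
Proof.
move=> ll H f f0; apply: (le_trans (H f f0)); apply: ler_wpM2r => //.
by apply: sumr_ge0 => v _; rewrite mulr_ge0 ?sqr_ge0 ?degree_ge0.
Qed.

(** Apply the gap to [f] minus its mean [m / r]; removing the mean lowers both the energy and the
    weighted square norm by [m ^+ 2 / r]. *)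
Lemma energy_le_mean lambda f : spectral_gap K lambda ->
  energy K f <= lambda * \sum_v degree K v * f v ^+ 2
    + (1 - lambda) * ((\sum_v degree K v * f v) ^+ 2 / \sum_v degree K v).
Proof.
move=> gapK; set r := \sum_v degree K v; set m := \sum_v degree K v * f v.
set q := \sum_v _ * _ ^+ 2.
have [r0|rn0] := eqVneq r 0.
  have := gapK f (sum_degree_eq0 f r0).
  by rewrite -/q r0 invr0 !mulr0 addr0.
have := gapK (fun v => f v - m / r).
have -> : \sum_v degree K v * (f v - m / r) = 0.
  under eq_bigr do rewrite mulrBr.
  by rewrite sumrB -mulr_suml -/m -/r mulrCA divff // mulr1 subrr.
have -> : \sum_v degree K v * (f v - m / r) ^+ 2 = q - m ^+ 2 / r.
  transitivity (q - 2 * (m / r) * m + (m / r) ^+ 2 * r).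
    move: (m / r) => t; rewrite /q /m /r !mulr_sumr -sumrB -big_split /=.
    by apply: eq_bigr => v _; ring.
  by field.
have -> : energy K (fun v => f v - m / r) = energy K f - m ^+ 2 / r.
  transitivity (energy K f - ((m / r) * m + (m / r) * m) + (m / r) ^+ 2 * r).
    have m1 : m = \sum_u \sum_v K u v * f u.
      by apply: eq_bigr => u _; rewrite mulr_suml.
    have m2 : m = \sum_u \sum_v K u v * f v.
      rewrite m1 exchange_big; apply: eq_bigr => u _; apply: eq_bigr => v _.
      by rewrite Ksym.
    move: (m / r) => t; rewrite [X in t * X + _]m1 [X in _ + t * X]m2.
    rewrite /r /degree /energy !mulr_sumr -big_split -sumrB -big_split /=.
    apply: eq_bigr => u _; rewrite !mulr_sumr -big_split -sumrB -big_split /=.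
    by apply: eq_bigr => v _; ring.
  by field.
move=> /(_ erefl); move: (m ^+ 2 / r) => t; lra.
Qed.

Lemma mixing lambda (A : {set T}) : 0 <= lambda -> spectral_gap K lambda ->
  \sum_(u in A) \sum_(v in A) K u v <=
    (\sum_(v in A) degree K v) ^+ 2 / (\sum_v degree K v)
    + lambda * \sum_(v in A) degree K v.
Proof.
move=> l0 /(energy_le_mean (fun v => (v \in A)%:R)).
have e1 (G : T -> R) : \sum_v G v * (v \in A)%:R = \sum_(v in A) G v.
  rewrite [RHS]big_mkcond; apply: eq_bigr => v _.
  by case: (v \in A); rewrite ?mulr1 ?mulr0.
have -> : \sum_v degree K v * (v \in A)%:R ^+ 2 = \sum_(v in A) degree K v.
  by rewrite -e1; apply: eq_bigr => v _; rewrite -natrX; case: (v \in A).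
have -> : energy K (fun v => (v \in A)%:R) = \sum_(u in A) \sum_(v in A) K u v.
  rewrite -e1; apply: eq_bigr => u _; rewrite -e1 mulr_suml.
  by apply: eq_bigr => v _; rewrite mulrAC.
rewrite e1 => /le_trans; apply; rewrite addrC lerD2r.
rewrite ler_piMl ?gerBl // divr_ge0 ?sqr_ge0 //.
by apply: sumr_ge0 => v _; apply: degree_ge0.
Qed.

(** For an eigenfunction, the sum of [K u v * (f u - f v) ^+ 2] is [2 * (1 - mu)] times its square
    norm. If [mu >= 1], then [f] is constant along edges, so by connectedness it is constant, and
    having mean 0 it vanishes. *)
Lemma eigenvalue_lt1 mu f : graph_connected K ->
  (exists2 v, degree K v != 0 & f v != 0) ->
  \sum_v degree K v * f v = 0 ->
  (forall u, \sum_v K u v * f v = mu * degree K u * f u) -> mu < 1.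
Proof.
move=> conK [v0 dv0 fv0] f0 Kf; rewrite ltNge; apply/negP => mu1.
set q := \sum_v degree K v * f v ^+ 2.
have q0 : 0 <= q.
  by apply: sumr_ge0 => v _; rewrite mulr_ge0 ?sqr_ge0 ?degree_ge0.
have E : energy K f = mu * q.
  rewrite /q mulr_sumr; apply: eq_bigr => u _.
  transitivity (f u * \sum_v K u v * f v); last by rewrite Kf; ring.
  by rewrite mulr_sumr; apply: eq_bigr => v _; ring.
have q1 : q = \sum_u \sum_v K u v * f u ^+ 2.
  by apply: eq_bigr => u _; rewrite mulr_suml.
have q2 : q = \sum_u \sum_v K u v * f v ^+ 2.
  rewrite q1 exchange_big; apply: eq_bigr => u _; apply: eq_bigr => v _.
  by rewrite Ksym.
have term_ge0 u v : 0 <= K u v * (f u - f v) ^+ 2 by rewrite mulr_ge0 ?sqr_ge0.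
have sum0 : \sum_u \sum_v K u v * (f u - f v) ^+ 2 <= 0.
  have -> : \sum_u \sum_v K u v * (f u - f v) ^+ 2 = q - 2 * energy K f + q.
    rewrite {1}q1 q2 /energy !mulr_sumr -sumrB -big_split /=.
    apply: eq_bigr => u _; rewrite !mulr_sumr -sumrB -big_split /=.
    by apply: eq_bigr => v _; ring.
  rewrite E; nra.
have eqf u v : 0 < K u v -> f u = f v.
  move=> Kuv; apply/eqP; rewrite -subr_eq0 -sqrf_eq0.
  have : K u v * (f u - f v) ^+ 2 <= 0.
    apply: le_trans sum0; rewrite (bigD1 u) //= (bigD1 v) //= -addrA lerDl.
    by rewrite addr_ge0 // sumr_ge0 // => w _; rewrite sumr_ge0.
  by rewrite pmulr_rle0 // => h; rewrite eq_le h sqr_ge0.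
have [c fc] := conK f eqf.
have dpos v : degree K v != 0 -> 0 < degree K v.
  by move=> dv; rewrite lt_neqAle eq_sym dv degree_ge0.
have c0 : c = 0.
  have r0 : 0 < \sum_v degree K v.
    rewrite (bigD1 v0) //= ltr_pwDl ?dpos //.
    by apply: sumr_ge0 => v _; apply: degree_ge0.
  move: f0; rewrite (eq_bigr (fun v => degree K v * c)) => [|v _].
    by rewrite -mulr_suml => /eqP; rewrite mulf_eq0 (gt_eqF r0) => /eqP.
  by have [->|/dpos/fc->] := eqVneq (degree K v) 0; rewrite ?mul0r.
by move: fv0; rewrite (fc v0) ?dpos // c0 eqxx.
Qed.

End OneGraph.

(* Oppenheim's trickling down: [L u] is the weighted graph of the link of the
   vertex u. *)
Lemma trickling_down K (L : T -> T -> T -> R) (D lambda : R) :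
  (forall u v, K u v = K v u) -> (forall u v, 0 <= K u v) ->
  (forall w u v, L w u v = L w v u) -> (forall w u v, 0 <= L w u v) ->
  0 < D -> 0 <= lambda -> lambda < 1 ->
  (forall u v, \sum_w L w u v = D * K u v) ->
  (forall w u, degree (L w) u = D * K w u) ->
  (forall w, degree K w != 0 -> spectral_gap (L w) lambda) ->
  graph_connected K -> spectral_gap K (lambda / (1 - lambda)).
Proof.
move=> Ksym K0 Lsym L0 D0 l0 l1 sumL degL gapL conK.
apply: spectral_gap_eigen => //.
  by rewrite divr_ge0 // subr_ge0 ltW.
move=> mu f fn f0 Kf.
have mu1 := eigenvalue_lt1 Ksym K0 conK fn f0 Kf.
set q := \sum_v degree K v * f v ^+ 2.
have q0 : 0 < q.
  have [v dv fv] := fn; rewrite /q (bigD1 v) //= ltr_pwDl //.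
    by rewrite mulr_gt0 ?exprn_even_gt0 // lt_neqAle eq_sym dv degree_ge0.
  by apply: sumr_ge0 => u _; rewrite mulr_ge0 ?sqr_ge0 ?degree_ge0.
have E : energy K f = mu * q.
  rewrite /q mulr_sumr; apply: eq_bigr => u _.
  transitivity (f u * \sum_v K u v * f v); last by rewrite Kf; ring.
  by rewrite mulr_sumr; apply: eq_bigr => v _; ring.
(* Localisation: the graphs [L w] together cover each edge of [K] with multiplicity [D]. *)
have ED : D * energy K f = \sum_w energy (L w) f.
  rewrite /energy mulr_sumr exchange_big /=; apply: eq_bigr => u _.
  rewrite mulr_sumr exchange_big /=; apply: eq_bigr => v _.
  by rewrite !mulrA -sumL !mulr_suml.
(* By the eigenvalue equation at [w], the mean of [f] in the link of [w] is [mu * f w]. *)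
have EL w : energy (L w) f <=
    lambda * (D * \sum_v K w v * f v ^+ 2) + (1 - lambda) * (D * (mu ^+ 2 * (degree K w * f w ^+ 2))).
  have -> : D * \sum_v K w v * f v ^+ 2 = \sum_v degree (L w) v * f v ^+ 2.
    by rewrite mulr_sumr; apply: eq_bigr => v _; rewrite degL mulrA.
  have [dw|dw] := eqVneq (degree K w) 0.
    have dL v : degree (L w) v = 0 by rewrite degL (degree_eq0 K0) // mulr0.
    rewrite /energy big1 => [|u _]; last by rewrite big1 // => v _; rewrite (degree_eq0 (L0 w)) ?dL // !mul0r.
    by rewrite dw mul0r !mulr0 addr0 big1 ?mulr0 // => v _; rewrite dL mul0r.
  have := energy_le_mean (Lsym w) (L0 w) f (gapL w dw).
  have -> : \sum_v degree (L w) v = D * degree K w.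
    by rewrite mulr_sumr; apply: eq_bigr => v _; rewrite degL.
  have -> : \sum_v degree (L w) v * f v = D * (mu * degree K w * f w).
    by rewrite -Kf mulr_sumr; apply: eq_bigr => v _; rewrite degL mulrA.
  suff -> : (D * (mu * degree K w * f w)) ^+ 2 / (D * degree K w)
     = D * (mu ^+ 2 * (degree K w * f w ^+ 2)) by [].
  by field; rewrite dw gt_eqF.
(* Dividing by [D * q] gives [mu <= lambda + (1 - lambda) mu^2], that is,
   [(1 - mu) (mu - lambda (1 + mu)) <= 0]; since [mu < 1], the second factor is at most 0. *)
have : D * (mu * q) <= D * (lambda * q + (1 - lambda) * (mu ^+ 2 * q)).
  rewrite -E ED; apply: le_trans (ler_sum _ (fun w _ => EL w)) _.
  rewrite big_split /= -!mulr_sumr exchange_big /=.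
  have -> : \sum_j \sum_i K i j * f j ^+ 2 = q.
    by apply: eq_bigr => v _; rewrite -mulr_suml; congr (_ * _); apply: eq_bigr => u _; rewrite Ksym.
  rewrite -/q le_eqVlt; apply/orP; left; apply/eqP; ring.
rewrite ler_pM2l // [(1 - lambda) * _]mulrA -mulrDl ler_pM2r // => H.
by rewrite ler_pdivlMr ?subr_gt0 //; nra.
Qed.

End WeightedGraphs.

(** * Weights of faces and links *)

Lemma bin_mul_bin N m a : (a <= m -> 'C(N, m) * 'C(m, a) = 'C(N, a) * 'C(N - a, m - a))%N.
Proof.
move=> am; have [mN|Nm] := leqP m N; last first.
  rewrite (bin_small Nm) mul0n; have [aN|Na] := leqP a N.
    by rewrite (@bin_small (N - a)) ?muln0 //; lia.
  by rewrite (bin_small Na).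
have aN := leq_trans am mN.
have p1 := bin_fact mN; have p2 := bin_fact am; have p3 := bin_fact aN.
have p4 : ('C(N - a, m - a) * ((m - a)`! * (N - m)`!) = (N - a)`!)%N.
  by rewrite -(_ : (N - a - (m - a) = N - m)%N) ?bin_fact //; lia.
have : (0 < a`! * (m - a)`! * (N - m)`!)%N by rewrite !muln_gt0 !fact_gt0.
move=> p0; apply/eqP; rewrite -(eqn_pmul2r p0); apply/eqP.
transitivity N`!.
  rewrite -p1 -p2; lia.
rewrite -p3 -p4; lia.
Qed.

Lemma cells_face (T : finType) (X : {set {set T}}) n x : x \in cells X n -> x \in X.
Proof. by rewrite inE => /andP[]. Qed.

Lemma cells_card (T : finType) (X : {set {set T}}) n x : x \in cells X n -> #|x| = n.
Proof. by rewrite inE => /andP[_ /eqP]. Qed.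

Section Weights.
Variables (R : realType) (T : finType) (d : nat) (X : {set {set T}}).
Hypothesis HX : is_dcomplex d X.
Implicit Types (x y z : {set T}) (u v : T).

Local Notation w := (weight R d X).

Definition facets_over x : {set {set T}} := [set y in cells X d.+1 | x \subset y].

Lemma weightE x : w x = #|facets_over x|%:R / ('C(d.+1, #|x|)%:R * #|cells X d.+1|%:R).
Proof. by []. Qed.

Lemma subface x y : y \in X -> x \subset y -> x \in X.
Proof. by case: HX => _ h _; apply: h. Qed.

Lemma card_face x : x \in X -> (#|x| <= d.+1)%N.
Proof.
by case: HX => _ _ h /h[y /cells_card <-]; apply: subset_leq_card.
Qed.

Lemma facets_over_gt0 x : x \in X -> (0 < #|facets_over x|)%N.
Proof.
case: HX => _ _ h /h[y yX xy]; apply/card_gt0P; exists y.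
by rewrite inE yX.
Qed.

Lemma facets_over_eq0 x : x \notin X -> #|facets_over x| = 0%N.
Proof.
move=> xX; apply/eqP; rewrite cards_eq0; apply/eqP/setP => y.
rewrite !inE; apply/negP => /andP[/andP[yX _] xy].
by rewrite (subface yX xy) in xX.
Qed.

Lemma card_facets_gt0 : (0 < #|cells X d.+1|)%N.
Proof.
have [X0 _ _] := HX; apply: leq_trans (facets_over_gt0 X0) _.
by apply: subset_leq_card; apply/subsetP => y; rewrite inE => /andP[].
Qed.

Lemma weight_ge0 x : 0 <= w x.
Proof. by rewrite weightE divr_ge0 // mulr_ge0. Qed.

Lemma weight_gt0 x : x \in X -> 0 < w x.
Proof.
move=> xX; rewrite weightE divr_gt0 ?ltr0n ?facets_over_gt0 //.
by rewrite mulr_gt0 // ltr0n ?bin_gt0 ?card_face // card_facets_gt0.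
Qed.

Lemma weight_eq0 x : x \notin X -> w x = 0.
Proof. by move=> xX; rewrite weightE facets_over_eq0 // mul0r. Qed.

Lemma weight_neq0 x : (w x != 0) = (x \in X).
Proof.
have [xX|xX] := boolP (x \in X); first by rewrite gt_eqF // weight_gt0.
by rewrite weight_eq0 // eqxx.
Qed.

Lemma weight0 : w set0 = 1.
Proof.
rewrite weightE cards0 bin0 mul1r (_ : facets_over set0 = cells X d.+1).
  by rewrite divff // pnatr_eq0 -lt0n card_facets_gt0.
by apply/setP => y; rewrite !inE sub0set andbT.
Qed.

Lemma card_between x y m : x \subset y -> (#|x| <= m)%N ->
  #|[set s : {set T} | [&& x \subset s, s \subset y & #|s| == m]]|
  = 'C(#|y| - #|x|, m - #|x|).
Proof.
move=> xy xm; have <- : #|y :\: x| = (#|y| - #|x|)%N.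
  by rewrite cardsD (setIidPr xy).
rewrite -cards_draws -[RHS](@card_in_imset _ _ (fun s => x :|: s)); last first.
  move=> s t; rewrite !inE !subsetD => /andP[/andP[_ sx] _] /andP[/andP[_ tx] _] E.
  move/setP: E => E; apply/setP => v; have := E v; rewrite !inE.
  by case: (boolP (v \in x)) => // vx _; rewrite (disjointFl sx vx) (disjointFl tx vx).
congr #|pred_of_set _|; apply/setP => s; rewrite inE; apply/and3P/imsetP.
  move=> [xs sy sm]; exists (s :\: x); last by rewrite setDE setUIr setUCr setIT (setUidPr xs).
  by rewrite inE setSD //= cardsD (setIidPr xs) (eqP sm).
move=> [t]; rewrite inE subsetD => /andP[/andP[ty tx] /eqP tm] ->; split.
- exact: subsetUl.
- by rewrite subUset xy.
- rewrite cardsU tm (_ : x :&: t = set0) ?cards0 ?subn0 ?subnKC //.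
  by apply/eqP; rewrite setI_eq0 disjoint_sym.
Qed.

Lemma sum_facets_over m x : (#|x| <= m)%N -> (m <= d.+1)%N ->
  (\sum_(y in cells X m | x \subset y) #|facets_over y|
   = 'C(d.+1 - #|x|, m - #|x|) * #|facets_over x|)%N.
Proof.
move=> xm md.
under eq_bigr do rewrite -sum1_card.
rewrite (exchange_big_dep (mem (facets_over x))) /=; last first.
  move=> y Y /andP[yX xy]; rewrite !inE => /andP[->] /=; exact: subset_trans.
rewrite [RHS]mulnC -sum_nat_const; apply: eq_bigr => Y.
rewrite inE => /andP[YX xY].
rewrite sum1_card -(cells_card YX) -card_between //.
apply: eq_card => y; rewrite !inE unfold_in /= !inE.
have [xy|] := boolP (x \subset y); last by rewrite andbF.
have [yY|] := boolP (y \subset Y); last by rewrite !andbF.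
move: YX; rewrite inE => /andP[YX ->].
by rewrite YX (subface YX yY) /= !andbT.
Qed.

(** On each level [w] is the law of a uniform subset of a uniform top face. Choosing it through an
    intermediate subset of size [m] gives the same law, and a face [y] over [x] then selects [x]
    with probability [1 / 'C(m, #|x|)]. *)
Lemma sum_weight_over m x : (#|x| <= m)%N -> (m <= d.+1)%N ->
  \sum_(y in cells X m | x \subset y) w y = 'C(m, #|x|)%:R * w x.
Proof.
move=> xm md; rewrite (eq_bigr (fun y => #|facets_over y|%:R / ('C(d.+1, m)%:R * #|cells X d.+1|%:R))).
  rewrite -mulr_suml -natr_sum sum_facets_over // weightE natrM.
  have := congr1 (fun i => i%:R : R) (bin_mul_bin d.+1 xm); rewrite !natrM => E.
  have n0 : #|cells X d.+1|%:R != 0 :> R by rewrite pnatr_eq0 -lt0n card_facets_gt0.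
  have c1 : 'C(d.+1, m)%:R != 0 :> R by rewrite pnatr_eq0 -lt0n bin_gt0.
  have c2 : 'C(d.+1, #|x|)%:R != 0 :> R.
    by rewrite pnatr_eq0 -lt0n bin_gt0 (leq_trans xm).
  apply: (mulfI c1); apply: (mulfI c2).
  rewrite [RHS](_ : _ = ('C(d.+1, m)%:R * 'C(m, #|x|)%:R) * #|facets_over x|%:R / #|cells X d.+1|%:R).
    by rewrite E; field; rewrite c1 n0.
  by field; rewrite c2 n0.
by move=> y /andP[/cells_card ym _]; rewrite weightE ym.
Qed.

Lemma sum_weight_cells m : (m <= d.+1)%N -> \sum_(y in cells X m) w y = 1.
Proof.
move=> md; have := @sum_weight_over m set0; rewrite cards0 bin0 weight0 mulr1.
by move=> /(_ isT md) E; rewrite -[RHS]E; apply: eq_bigl => y; rewrite sub0set andbT.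
Qed.

Lemma sum_weightU1 x : (#|x| <= d)%N ->
  \sum_(v | v \notin x) w (v |: x) = #|x|.+1%:R * w x.
Proof.
move=> xd; have := @sum_weight_over #|x|.+1 x (leqnSn _) xd.
rewrite binSn => <-.
rewrite -(@big_imset _ _ _ _ _ (fun v => v |: x) (fun v => v \notin x) w) /=; last first.
  move=> u v ux vx /setP/(_ u); rewrite !inE eqxx /= => /esym/orP[/eqP//|].
  by rewrite (negPf ux).
rewrite [LHS](bigID (mem X)) /= [X in _ + X]big1 ?addr0; last first.
  by move=> y /andP[_]; apply: weight_eq0.
apply: eq_bigl => y; apply/andP/andP.
  move=> [/imsetP[v vx ->] yX]; split; last exact: subsetUr.
  have vx' : v \notin x := vx.
  have yX' : v |: x \in X := yX.
  by rewrite inE yX' cardsU1 vx' /=.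
rewrite inE => -[/andP[yX /eqP yx] xy]; split=> //.
have /cards1P[v yv] : #|y :\: x| == 1%N.
  by rewrite cardsD (setIidPr xy) yx subSnn.
apply/imsetP; exists v; first by have : v \in y :\: x by [rewrite yv inE]; rewrite inE => /andP[].
by rewrite -yv setUC setDE setUIr setUCr setIT (setUidPr xy).
Qed.

Section Link.
Variable z : {set T}.
Hypotheses (zX : z \in X) (zd : (#|z| <= d)%N).

Lemma mem_link x : (x \in link X z) = (x :|: z \in X) && [disjoint x & z].
Proof.
apply/idP/andP; first exact: link_setU.
move=> [xzX dxz]; apply/imsetP; exists (x :|: z).
  by rewrite inE xzX subsetUr.
rewrite setDUl setDv setU0; apply/esym/setDidPl => //.
Qed.

Lemma cardsUdisj x : [disjoint x & z] -> #|x :|: z| = (#|x| + #|z|)%N.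
Proof. by move=> dxz; rewrite cardsU disjoint_setI0 // cards0 subn0. Qed.

Lemma mem_link_cells m x :
  (x \in cells (link X z) m) = (x :|: z \in cells X (m + #|z|)) && [disjoint x & z].
Proof.
rewrite !inE mem_link -!andbA; congr (_ && _); rewrite andbC.
by have [dxz|] := boolP [disjoint x & z]; rewrite ?andbF //= cardsUdisj // eqn_add2r andbT.
Qed.

Lemma big_link_cells (V : nmodType) m (P : pred {set T}) (G : {set T} -> V) :
  \sum_(x in cells (link X z) m | P (x :|: z)) G (x :|: z)
  = \sum_(y in cells X (m + #|z|) | (z \subset y) && P y) G y.
Proof.
rewrite [RHS](reindex_onto (fun x => x :|: z) (fun y => y :\: z)) /=; last first.
  by move=> y /and3P[_ zy _]; rewrite setUC setDE setUIr setUCr setIT (setUidPr zy).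
apply: eq_bigl => x; rewrite mem_link_cells subsetUr /= -!andbA; congr (_ && _).
rewrite andbC; congr (_ && _).
by rewrite setDUl setDv setU0; apply/setDidPl/eqP.
Qed.

(** The weight of a link is that of [X] conditioned on containing [z]: top faces of the link are top
    faces of [X] over [z], and the binomial counts the choices of [z] inside [x :|: z]. *)
Lemma weight_link x : [disjoint x & z] ->
  weight R (d - #|z|) (link X z) x = w (x :|: z) / ('C(#|x| + #|z|, #|z|)%:R * w z).
Proof.
move=> dxz.
have facetsE (t : {set T}) : [disjoint t & z] ->
    #|[set y in cells (link X z) (d - #|z|).+1 | t \subset y]| = #|facets_over (t :|: z)|.
  move=> dtz; rewrite -[LHS]sum1_card -[RHS]sum1_card.
  have := @big_link_cells nat (d - #|z|).+1 (fun y => t :|: z \subset y) (fun _ => 1%N).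
  have -> : ((d - #|z|).+1 + #|z| = d.+1)%N by rewrite addSn subnK.
  move=> E; transitivity (\sum_(x0 in cells (link X z) (d - #|z|).+1 | t :|: z \subset x0 :|: z) 1)%N.
    apply: eq_bigl => y; rewrite !inE; case: (boolP (y \in link X z)) => //=.
    rewrite mem_link => /andP[_ dyz]; congr (_ && _).
    apply/idP/idP; first exact: setSU.
    move=> /subsetP ty; apply/subsetP => v vt.
    have := ty v; rewrite !inE vt /= => /(_ isT) /orP[//|].
    by rewrite (disjointFr dtz vt).
  rewrite E; apply: eq_bigl => y; rewrite [RHS]inE; congr (_ && _).
  have [zy|nzy] := boolP (z \subset y) => //=.
  by apply/esym/negbTE; apply: contraNN nzy; apply: subset_trans (subsetUr _ _).
have cE : #|cells (link X z) (d - #|z|).+1| = #|facets_over z|.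
  rewrite -[z in RHS]set0U -facetsE; last by rewrite -setI_eq0 set0I.
  by congr #|pred_of_set _|; apply/setP => y; rewrite [RHS]inE sub0set andbT.
rewrite /weight facetsE // cE -!/(facets_over _) cardsUdisj //.
have := congr1 (fun i => i%:R : R) (bin_mul_bin d.+1 (leq_addl #|x| #|z|)).
rewrite !natrM addnK => E.
have [xzd|xzd] := leqP (#|x| + #|z|) d.+1; last first.
  rewrite facets_over_eq0 ?mul0r //.
  by apply/negP => /card_face; rewrite cardsUdisj // leqNgt xzd.
have n0 : #|cells X d.+1|%:R != 0 :> R by rewrite pnatr_eq0 -lt0n card_facets_gt0.
have z0 : #|facets_over z|%:R != 0 :> R by rewrite pnatr_eq0 -lt0n facets_over_gt0.
have c1 : 'C(d.+1, #|x| + #|z|)%:R != 0 :> R by rewrite pnatr_eq0 -lt0n bin_gt0.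
have c2 : 'C(#|x| + #|z|, #|z|)%:R != 0 :> R by rewrite pnatr_eq0 -lt0n bin_gt0 leq_addl.
have c3 : 'C(d.+1, #|z|)%:R != 0 :> R by rewrite pnatr_eq0 -lt0n bin_gt0 (leq_trans zd).
have c4 : 'C((d - #|z|).+1, #|x|)%:R != 0 :> R by rewrite pnatr_eq0 -lt0n bin_gt0; lia.
rewrite -subSn // in c4 *.
apply: (mulfI c1); apply: (mulfI c2).
rewrite [RHS](_ : _ = 'C(d.+1, #|z|)%:R * #|facets_over (x :|: z)|%:R / #|facets_over z|%:R).
  rewrite mulrA [_ * 'C(d.+1, _)%:R]mulrC E; field.
  by rewrite c4 z0.
by field; rewrite c1 c2 c3 n0 z0.
Qed.

Lemma sum_weight_link m (P : pred {set T}) :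
  \sum_(x in cells (link X z) m | P (x :|: z)) weight R (d - #|z|) (link X z) x
  = (\sum_(y in cells X (m + #|z|) | (z \subset y) && P y) w y)
      / ('C(m + #|z|, #|z|)%:R * w z).
Proof.
rewrite mulr_suml -big_link_cells; apply: eq_bigr => x /andP[xl _].
have := xl; rewrite mem_link_cells => /andP[_ dxz].
by rewrite weight_link // (cells_card xl).
Qed.

End Link.

End Weights.

(** * Spectral gap of the links *)

Section LinkGraphs.
Variables (R : realType) (T : finType) (d : nat) (X : {set {set T}}).
Hypothesis HX : is_dcomplex d X.
Implicit Types (x y z : {set T}) (u v : T).

Local Notation w := (weight R d X).

(** The 1-skeleton of the link, as a graph on all of [T]. The weights of [X] are used instead of
    those of the link: this rescales by a constant, and gives the identities of [trickling_down]
    with the exact factor [#|z| + 3]. *)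
Definition link_graph z u v : R :=
  if [&& u != v, u \notin z & v \notin z] then w (u |: (v |: z)) else 0.

Lemma link_graph_sym z u v : link_graph z u v = link_graph z v u.
Proof.
rewrite /link_graph eq_sym [(u \notin z) && _]andbC; case: ifP => // _.
by rewrite setUCA.
Qed.

Lemma link_graph_ge0 z u v : 0 <= link_graph z u v.
Proof. by rewrite /link_graph; case: ifP => // _; apply: weight_ge0. Qed.

Lemma degree_link_graph z u : (#|z| < d)%N ->
  degree (link_graph z) u = if u \in z then 0 else #|z|.+2%:R * w (u |: z).
Proof.
move=> zd; rewrite /degree; have [uz|uz] := boolP (u \in z).
  by rewrite big1 // => v _; rewrite /link_graph uz andbF.
have <- : #|u |: z|.+1 = #|z|.+2 by rewrite cardsU1 uz.
rewrite -(sum_weightU1 R HX) ?cardsU1 ?uz // [RHS]big_mkcond.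
apply: eq_bigr => v _; rewrite /link_graph uz !inE negb_or eq_sym /=.
by rewrite setUCA.
Qed.

Lemma sum_degree_link_graph z : (#|z| < d)%N ->
  \sum_u degree (link_graph z) u = #|z|.+2%:R * (#|z|.+1%:R * w z).
Proof.
move=> zd; rewrite -(sum_weightU1 R HX (ltnW zd)) mulr_sumr [RHS]big_mkcond.
by apply: eq_bigr => u _; rewrite degree_link_graph // if_neg.
Qed.

Lemma adjacent_link z u v : adjacent (link X z) u v =
  [&& u != v, u \notin z & v \notin z] && (u |: (v |: z) \in X).
Proof.
rewrite /adjacent /= mem_link -andbA; congr (_ && _).
rewrite andbC -setUA; congr (_ && _).
by rewrite -setI_eq0 setIUl setU_eq0 !setI_eq0 !disjoints1.
Qed.

Lemma link_graph_gt0 z u v : (0 < link_graph z u v) = adjacent (link X z) u v.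
Proof.
rewrite adjacent_link /link_graph; case: ifP => /= _; last by rewrite ltxx.
by rewrite lt_neqAle weight_ge0 andbT eq_sym (weight_neq0 R HX).
Qed.

Lemma set1_link z v : ([set v] \in link X z) = (v \notin z) && (v |: z \in X).
Proof. by rewrite mem_link disjoints1 andbC. Qed.

Lemma link_graph_connected z : z \in X -> (#|z| < d)%N ->
  is_connected (link X z) -> graph_connected (link_graph z).
Proof.
move=> zX zd con f fE.
have degP v : 0 < degree (link_graph z) v -> [set v] \in link X z.
  rewrite degree_link_graph // set1_link; case: ifP => [_|_ /=]; first by rewrite ltxx.
  rewrite pmulr_rgt0 ?ltr0n // => wv; rewrite -(weight_neq0 R HX).
  by rewrite gt_eqF.
have [[v0 /degP v0P]|none] := pselect (exists v, 0 < degree (link_graph z) v); last first.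
  by exists 0 => v dv; case: none; exists v.
exists (f v0) => v /degP vP.
have /connectP[p pth ->] := con _ _ vP v0P.
elim: p v pth {vP} => //= u p IH v /andP[vu pth].
by rewrite -(IH u pth); apply: fE; rewrite link_graph_gt0.
Qed.

(** Dividing by degrees gives the adjacency operator of the link: the 2 in its definition cancels
    against the one in ['C(#|z|.+2, #|z|) = (#|z| + 2) (#|z| + 1) / 2], which comes from the weight
    of an edge. *)
Lemma link_graph_gap_base z (lambda : R) : z \in X -> (#|z| < d)%N -> 0 <= lambda ->
  spectral_expander (d - #|z|) (link X z) lambda ->
  spectral_gap (link_graph z) lambda.
Proof.
move=> zX zd l0 spec; have zd' := ltnW zd.
apply: spectral_gap_eigen => //; [exact: link_graph_sym | exact: link_graph_ge0 |].
have w1 v : [set v] \in link X z ->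
    weight R (d - #|z|) (link X z) [set v] = w (v |: z) / (#|z|.+1%:R * w z).
  rewrite set1_link => /andP[vz _]; rewrite (weight_link R HX) ?disjoints1 //.
  by rewrite cards1 add1n binSn.
move=> mu f [v0 dv0 fv0] f0 Kf.
suff /andP[] : -1 <= mu <= lambda by [].
have zw : w z != 0 by rewrite (weight_neq0 R HX).
have n0 n : n.+1%:R != 0 :> R by rewrite pnatr_eq0.
have dE v : [set v] \in link X z -> degree (link_graph z) v = #|z|.+2%:R * w (v |: z).
  by rewrite set1_link degree_link_graph // => /andP[/negPf->].
have d0 v : [set v] \notin link X z -> degree (link_graph z) v = 0.
  rewrite set1_link degree_link_graph //; case: ifP => //= _ vz.
  by rewrite (weight_eq0 R HX) // mulr0.
apply: (spec mu f).
- by exists v0 => //; apply: contraNT dv0 => /d0->.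
- have : (\sum_v degree (link_graph z) v * f v) / (#|z|.+2%:R * (#|z|.+1%:R * w z)) = 0.
    by rewrite f0 mul0r.
  move=> E; rewrite -[RHS]E mulr_suml big_mkcond; apply: eq_bigr => v _.
  case: ifP => [vl|/negbT/d0->]; last by rewrite !mul0r.
  rewrite w1 // dE //; move: (n0 #|z|.+1) (n0 #|z|) zw.
  move: (#|z|.+2%:R : R) (#|z|.+1%:R : R) (w z) => a b c a0 b0 c0.
  by field; rewrite ?a0 ?b0 ?c0.
- move=> v vl; have wv : w (v |: z) != 0.
    by move: vl; rewrite set1_link (weight_neq0 R HX) => /andP[].
  have : (\sum_u link_graph z v u * f u) / (#|z|.+2%:R * w (v |: z)) = mu * f v.
    rewrite Kf dE //; move: (n0 #|z|.+1) wv; move: (#|z|.+2%:R : R) (w _) => a b a0 b0.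
    by field; rewrite ?a0 ?b0.
  move=> <-; rewrite mulr_suml /adjacency big_mkcond; apply: eq_bigr => u _.
  have := adjacent_link z v u; case: ifP => [_ /esym/andP[vuz vuX]|]; last first.
    rewrite -link_graph_gt0 => vu _.
    have -> : link_graph z v u = 0; last by rewrite !mul0r.
    by apply/eqP; rewrite eq_le link_graph_ge0 andbT leNgt vu.
  rewrite /link_graph vuz w1 //; case/and3P: vuz => vu vz uz.
  rewrite (weight_link R HX) //; last by rewrite -setI_eq0 setIUl setU_eq0 !setI_eq0 !disjoints1 vz.
  rewrite cards2 vu add2n -setUA.
  have -> : 'C(#|z|.+2, #|z|)%:R = #|z|.+2%:R * #|z|.+1%:R / 2 :> R.
    have := bin_sub (isT : (2 <= #|z|.+2)%N); rewrite subSS subSS subn0 => ->.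
    have := mul_bin_diag #|z|.+2 1; rewrite bin1 /= => /(congr1 (fun i => i%:R : R)).
    by rewrite !natrM => E; apply: (mulfI (n0 1%N)); rewrite -E; field.
  move: zw wv (n0 #|z|.+1) (n0 #|z|).
  move: (#|z|.+2%:R : R) (#|z|.+1%:R : R) (w z) (w (v |: z)) => a b c e c0 e0 a0 b0.
  by field; rewrite ?a0 ?b0 ?c0 ?e0.
Qed.

(* With lambda_m = lambda / (1 - (d - 1 - m) lambda), one has
   lambda_(m-1) = lambda_m / (1 - lambda_m). *)
Lemma link_graph_gap (lambda : R) z : 0 <= lambda -> lambda <= d%:R^-1 ->
  (2 <= d)%N -> strongly_connected d X ->
  local_spectral_expander d X (d - 2) lambda ->
  z \in X -> (#|z| < d)%N -> spectral_gap (link_graph z) (d%:R * lambda).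
Proof.
move=> l0 ld d2 scX spec zX zd.
have d0 : 0 < d%:R :> R by rewrite ltr0n; lia.
have dl1 : d%:R * lambda <= 1 by rewrite mulrC -ler_pdivlMr // mul1r.
(* From [lambda <= 1 / d] follows [1 - a * lambda >= 1 / d] for [a < d], so the bound after [a]
   trickling steps, [lambda / (1 - a * lambda)], never exceeds [d * lambda]. This is the origin of
   the factor [1 / d] in the theorem. *)
have den a : (a < d)%N -> lambda <= d%:R * lambda * (1 - a%:R * lambda).
  move=> ad; have : a.+1%:R <= d%:R :> R by rewrite ler_nat.
  rewrite -natr1; move: dl1 l0 (ler0n R a); move: (a%:R : R) (d%:R : R) => aa dd dl1 l0 a0 aad.
  have : 0 <= lambda * (dd - 1 - aa) by rewrite mulr_ge0 //; lra.
  have : 0 <= (aa * lambda) * (1 - dd * lambda) by rewrite !mulr_ge0 //; lra.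
  nra.
have den_gt0 a : (a < d)%N -> 0 < 1 - a%:R * lambda.
  move=> ad; have : a.+1%:R <= d%:R :> R by rewrite ler_nat.
  rewrite -natr1 => aad; rewrite -(pmulr_rgt0 _ d0) mulrBr mulr1 mulrCA.
  have : a%:R * (d%:R * lambda) <= a%:R by rewrite ler_piMr.
  lra.
suff H a z' : (#|z'| + a)%N = d.-1 -> z' \in X ->
    spectral_gap (link_graph z') (lambda / (1 - a%:R * lambda)).
  have {}H := H (d.-1 - #|z|)%N z; apply: (spectral_gap_le (link_graph_ge0 z)); last first.
    by apply: H => //; lia.
  have ad : (d.-1 - #|z| < d)%N by lia.
  by rewrite ler_pdivrMr ?den_gt0 ?den.
elim: a z' {z zX zd} => [|a IH] z' za zX.
  rewrite addn0 in za; rewrite mul0r subr0 divr1.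
  apply: link_graph_gap_base => //; first by lia.
  by apply: spec; rewrite inE zX za /=; apply/eqP; lia.
have zd : (#|z'| < d)%N by lia.
have zd1 : (#|z'|.+1 < d)%N by lia.
have pos : 0 < 1 - a.+1%:R * lambda by apply: den_gt0; lia.
have lam1 : 0 < 1 - a%:R * lambda by apply: den_gt0; lia.
have -> : lambda / (1 - a.+1%:R * lambda) =
    lambda / (1 - a%:R * lambda) / (1 - lambda / (1 - a%:R * lambda)).
  rewrite -[in LHS]natr1 mulrDl mul1r in pos *.
  by field; rewrite !gt_eqF //; lra.
pose L u : T -> T -> R := if u \in z' then fun _ _ => 0 else link_graph (u |: z').
apply: (@trickling_down R T _ L (#|z'|.+3%:R)).
- exact: link_graph_sym.
- exact: link_graph_ge0.
- by move=> u v v'; rewrite /L; case: ifP => // _; apply: link_graph_sym.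
- by move=> u v v'; rewrite /L; case: ifP => // _; apply: link_graph_ge0.
- by rewrite ltr0n.
- by rewrite divr_ge0 // ltW.
- by rewrite ltr_pdivrMr // mul1r; move: pos; rewrite -natr1; lra.
- move=> u v; rewrite /L [in RHS]/link_graph; case: ifP => [/and3P[uv uz vz]|H].
    have uvz : u \notin v |: z' by rewrite !inE negb_or uv.
    have <- : #|u |: (v |: z')|.+1 = #|z'|.+3 by rewrite !cardsU1 uvz vz.
    rewrite -(sum_weightU1 R HX) ?cardsU1 ?uvz ?vz // [RHS]big_mkcond.
    apply: eq_bigr => t _; rewrite !inE !negb_or.
    have [tz|tz] := boolP (t \in z'); first by rewrite !andbF.
    rewrite /link_graph !inE !negb_or uv uz vz /= !andbT [u == t]eq_sym [v == t]eq_sym.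
    by case: ifP => // _; rewrite [v |: (t |: _)]setUCA [u |: (t |: _)]setUCA.
  rewrite mulr0 big1 // => t _; case: ifP => // tz.
  rewrite /link_graph; case: ifP => // /and3P[uv].
  rewrite !inE !negb_or => /andP[_ uz] /andP[_ vz].
  by rewrite uv uz vz in H.
- move=> u v; rewrite /L; have [uz|uz] := boolP (u \in z').
    by rewrite /degree big1 // /link_graph uz andbF mulr0.
  rewrite degree_link_graph cardsU1 uz // !inE /link_graph uz [u == v]eq_sym.
  have [vu|vu] := boolP (v == u); have [vz|vz] := boolP (v \in z'); rewrite /= ?mulr0 //.
  by rewrite add1n setUCA.
- move=> u; rewrite degree_link_graph // /L; case: ifP => [_|uz]; first by rewrite eqxx.
  rewrite mulf_eq0 negb_or (weight_neq0 R HX) => /andP[_ uX].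
  apply: IH => //; rewrite cardsU1 uz; lia.
- by apply: link_graph_connected => //; apply: scX.
Qed.

End LinkGraphs.

(** * Cochains *)

Section Alternating.
Variable T : finType.
Implicit Types x y z : {set T}.

Definition permt n (p : 'S_n) (t : n.-tuple T) : n.-tuple T := [tuple tnth t (p i) | i < n].

Definition alternating (V : zmodType) n (g : seq T -> V) : Prop :=
  forall (t : n.-tuple T) (p : 'S_n), g (permt p t) = g t *~ (-1) ^+ p.

Lemma permtM n (p q : 'S_n) t : permt p (permt q t) = permt (p * q)%g t.
Proof. by apply: eq_from_tnth => i; rewrite !tnth_mktuple permM. Qed.

Lemma permt1 n (t : n.-tuple T) : permt 1%g t = t.
Proof. by apply: eq_from_tnth => i; rewrite !tnth_mktuple perm1. Qed.

Lemma alternating_tperm (V : zmodType) n (g : seq T -> V) :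
  (forall (t : n.-tuple T) i j, i != j -> g (permt (tperm i j) t) = - g t) ->
  alternating n g.
Proof.
move=> H t p; have [ts -> tsd] := prod_tpermP p.
elim: ts tsd t => [|[i j] ts IH].
  by move=> _ t; rewrite big_nil odd_perm1 permt1.
move=> /andP[ij' tsd] t; have ij : i != j := ij'; rewrite big_cons -permtM H // IH //.
by rewrite odd_permM odd_tperm ij signr_addb mulN1r mulrNz.
Qed.

Lemma alternating_cat (V : zmodType) m n (g : seq T -> V) s :
  size s = n -> alternating (m + n) g -> alternating m (fun t => g (t ++ s)).
Proof.
move=> sn alt; apply: alternating_tperm => t i j ij.
have sP : size s == n by apply/eqP.
pose s' := Tuple sP.
have := alt (cat_tuple t s') (tperm (lshift n i) (lshift n j)).
rewrite odd_tperm (inj_eq (@lshift_inj _ _)) ij expr1 mulrNz mulr1z => <-.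
congr g; rewrite -[s]/(val s') -[LHS]/(val (cat_tuple (permt (tperm i j) t) s')).
congr val; apply: eq_from_tnth => k; rewrite tnth_mktuple.
rewrite -[k]splitK; case: (split k) => l /=.
  rewrite tnth_lshift tnth_mktuple.
  have [->|->|li lj] := tpermP i j l.
  - by rewrite tpermL tnth_lshift.
  - by rewrite tpermR tnth_lshift.
  by rewrite tpermD ?tnth_lshift // (inj_eq (@lshift_inj _ _)) eq_sym; apply/eqP.
by rewrite tpermD ?eq_lrshift // !tnth_rshift.
Qed.

(* For a list [v] without repetitions, the sign of the permutation from [v] to
   [u], computed as the determinant of its matrix. *)
Definition relsign n (u v : seq T) : int :=
  \det (\matrix_(i < n, j < n) (onth u i == onth v j)%:R).

Lemma onth_tuple n (t : n.-tuple T) (i : 'I_n) : onth t i = Some (tnth t i).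
Proof. by rewrite (tnth_nth (tnth t i)) onthE (nth_map (tnth t i)) // size_tuple. Qed.

Lemma alternating_relsign n v : alternating n (fun u => relsign n u v).
Proof.
move=> t p; rewrite /relsign -mulrzl intz -det_perm -det_mulmx -row_permE.
congr (\det _); apply/matrixP => i j.
by rewrite !mxE !onth_tuple tnth_mktuple.
Qed.

Lemma relsign_id n u : uniq u -> size u = n -> relsign n u u = 1.
Proof.
move=> uu un; rewrite /relsign [X in \det X](_ : _ = 1%:M) ?det1 //; apply/matrixP => i j.
have uP : size u == n by apply/eqP.
have := (onth_tuple (Tuple uP)) => /= E.
by rewrite !mxE !E (inj_eq Some_inj) (inj_eq (elimT (tuple_uniqP (Tuple uP)) uu)).
Qed.

Lemma ordering_size x (s : seq T) : ordering x s -> size s = #|x|.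
Proof. by case/andP => us /eqP <-; rewrite cardsE; apply/esym/card_uniqP. Qed.

Lemma ordering_mem x (s : seq T) : ordering x s -> s =i x.
Proof. by case/andP => us /eqP <- v; rewrite inE. Qed.

Lemma orderingP x (s : seq T) : reflect (uniq s /\ s =i x) (ordering x s).
Proof.
apply: (iffP idP) => [o|[us sx]]; first by split; [case/andP: o | exact: ordering_mem].
by rewrite /ordering us; apply/eqP/setP => v; rewrite inE.
Qed.

Lemma ordering_enum (x : {set T}) : ordering x (enum x).
Proof. by apply/orderingP; split; [exact: enum_uniq | move=> v; rewrite mem_enum]. Qed.

Lemma ordering_permt n x (t : n.-tuple T) (p : 'S_n) : ordering x (permt p t) = ordering x t.
Proof.
have pe : perm_eq (permt p t) t by apply/tuple_permP; exists p.
rewrite /ordering (perm_uniq pe); congr (_ && (_ == _)).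
by apply/setP => v; rewrite !inE (perm_mem pe).
Qed.

Lemma ordering_cat x z (t s : seq T) : ordering z s ->
  ordering x t && [disjoint x & z] = ordering (x :|: z) (t ++ s) && [disjoint x & z].
Proof.
move=> /orderingP[us sz]; have [dxz|] := boolP [disjoint x & z]; last by rewrite !andbF.
rewrite !andbT; apply/orderingP/orderingP => -[ut tx]; split.
- rewrite cat_uniq ut us andbT /=; apply/hasPn => v; rewrite sz tx => vz.
  by rewrite (disjointFl dxz vz).
- by move=> v; rewrite mem_cat inE tx sz.
- by move: ut; rewrite cat_uniq => /andP[].
- move=> v; have := tx v; rewrite mem_cat inE sz; have [vz _|] := boolP (v \in z).
    move: ut; rewrite cat_uniq => /and3P[_ /hasPn/(_ v)]; rewrite sz => /(_ vz) /negPf -> _.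
    by rewrite (disjointFl dxz vz).
  by rewrite !orbF.
Qed.

Lemma orderings_permt n x (s t : seq T) : #|x| = n -> ordering x s -> ordering x t ->
  exists (u : n.-tuple T) (p : 'S_n), t = u /\ s = permt p u.
Proof.
move=> xn sx tx; have tP : size t == n by rewrite (ordering_size tx) xn.
have /tuple_permP[p sp] : perm_eq s (Tuple tP).
  case/orderingP: sx => us sx; case/orderingP: tx => ut tx.
  by apply: uniq_perm => // v; rewrite sx -tx.
by exists (Tuple tP), p.
Qed.

End Alternating.

Section Differential.
Variables (T : finType) (d : nat) (X : {set {set T}}) (F : augSheaf X).
Hypothesis HX : is_dcomplex d X.
Implicit Types (x y z : {set T}) (s t : seq T) (f g h : cochain F).

Lemma cochain_ext f g : cochain_eq f g -> f = g.
Proof.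
move=> E; apply: functional_extensionality_dep => x.
by apply: funext => s; apply: E.
Qed.

Lemma cochain_supp n f x s : is_cochain n f -> f x s != 0 ->
  x \in cells X n /\ ordering x s.
Proof.
move=> [f0 _]; apply: contraNP => H; apply/eqP/f0; apply/negP => /andP[xn xs].
by apply: H.
Qed.

Lemma cochain_alternating n f x : is_cochain n f -> alternating n (f x).
Proof. by move=> [_ H] t p; apply: H. Qed.

Lemma cochain_eq0 n f x s t : is_cochain n f -> ordering x s -> ordering x t ->
  (f x s == 0) = (f x t == 0).
Proof.
move=> cf xs xt; have [xn|xn] := boolP (x \in cells X n); last first.
  by rewrite !(proj1 cf) // negb_and xn.
have [u [p [-> ->]]] := orderings_permt (cells_card xn) xs xt.
rewrite (cochain_alternating x cf); case: (odd_perm p); rewrite ?mulr1z //.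
by rewrite expr1 mulrNz mulr1z oppr_eq0.
Qed.

Lemma mem_support n f x s : is_cochain n f -> ordering x s ->
  (x \in Defs.support n f) = (f x s != 0).
Proof.
move=> cf xs; rewrite in_set (cochain_eq0 cf (ordering_enum x) xs).
have [//|xn] := boolP (x \in cells X n).
by rewrite (proj1 cf) ?eqxx // negb_and xn.
Qed.

Lemma mem_supportE n f x :
  (x \in Defs.support n f) = (x \in cells X n) && (f x (enum x) != 0).
Proof. by rewrite in_set. Qed.

Lemma support_cells n f x : x \in Defs.support n f -> x \in cells X n.
Proof. by rewrite in_set => /andP[]. Qed.

Lemma cochainD n f g : is_cochain n f -> is_cochain n g -> is_cochain n (cochain_add f g).
Proof.
move=> cf cg; split=> [x s xs|x t p]; rewrite /cochain_add.
  by rewrite (proj1 cf) // (proj1 cg) // addr0.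
by rewrite (proj2 cf) (proj2 cg) mulrzDl.
Qed.

Definition restr (L : {set {set T}}) f : cochain F := fun x s => if x \in L then f x s else 0.

Lemma restr_cochain n L f : is_cochain n f -> is_cochain n (restr L f).
Proof.
move=> cf; split=> [x s xs|x t p]; rewrite /restr; case: ifP => //.
- by rewrite (proj1 cf).
- by rewrite (proj2 cf).
- by rewrite mul0rz.
Qed.

Lemma size_omit s i : (i < size s)%N -> size (omit s i) = (size s).-1.
Proof. by move=> si; rewrite size_cat size_take size_drop si; lia. Qed.

Lemma nth_omit v0 s i j : (i < size s)%N -> nth v0 (omit s i) j = nth v0 s (bump i j).
Proof.
move=> si; rewrite nth_cat size_take si nth_drop /bump; case: ltnP => ij /=.
  by rewrite nth_take // leqNgt ij.
by congr nth; lia.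
Qed.

Lemma ordering_omit v0 y s i : ordering y s -> (i < size s)%N ->
  ordering (y :\ nth v0 s i) (omit s i).
Proof.
move=> /orderingP[us sy] si.
have E : s = take i s ++ nth v0 s i :: drop i.+1 s.
  by rewrite -drop_nth // cat_take_drop.
have pe : perm_eq s (nth v0 s i :: omit s i).
  by rewrite {1}E perm_catC /= perm_cons perm_catC.
have := us; rewrite (perm_uniq pe) /= => /andP[vn uo].
apply/orderingP; split => // v; rewrite !inE -sy (perm_mem pe) inE.
by have [->|_] //= := eqVneq v; rewrite (negPf vn).
Qed.

Definition dterm v0 f y s (i : nat) : F y :=
  res F (y :\ nth v0 s i) y (f (y :\ nth v0 s i) (omit s i)) *~ (-1) ^+ i.

Lemma differentialE v0 f y s : y \in X -> ordering y s ->
  differential f y s = \sum_(i < size s) dterm v0 f y s i.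
Proof.
move=> yX ys; rewrite /differential yX ys /=; apply: eq_bigr => i _.
by rewrite /dterm (tnth_nth v0).
Qed.

(** Here [q] is the permutation induced on the vertices that remain after one is omitted; it relates
    the terms of a differential at two orderings of the same face. *)
Lemma lift_perm_surj n (p : 'S_n.+1) i :
  exists q : 'S_n, p = lift_perm i (p i) q.
Proof.
pose q k := odflt k (unlift (p i) (p (lift i k))).
have qE k : lift (p i) (q k) = p (lift i k).
  rewrite /q; case: unliftP => [j -> //|/perm_inj E].
  by have := neq_lift i k; rewrite E eqxx.
have q_inj : injective q.
  by move=> j k E; apply: (@lift_inj _ i); apply: (@perm_inj _ p); rewrite -!qE E.
exists (perm q_inj); apply/permP => k.
case: (unliftP i k) => [j ->|->]; last by rewrite lift_perm_id.
by rewrite lift_perm_lift permE qE.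
Qed.

Lemma omit_permt (v0 : T) n (t : n.+1.-tuple T) (p : 'S_n.+1) i q (u : n.-tuple T) :
  p = lift_perm i (p i) q -> u = omit t (p i) :> seq T ->
  omit (permt p t) i = permt q u.
Proof.
move=> pE uE.
have sz (t' : n.+1.-tuple T) (j : 'I_n.+1) : (j < size t')%N by rewrite size_tuple.
apply: (@eq_from_nth _ v0); first by rewrite size_omit ?sz // !size_tuple.
move=> k0; rewrite size_omit ?sz // size_tuple /= => kn.
have [{kn}k ->] : exists k' : 'I_n, k0 = k' by exists (Ordinal kn).
rewrite nth_omit ?sz //.
have nthp m (p' : 'S_m) (t' : m.-tuple T) (j : 'I_m) :
    nth v0 (permt p' t') j = nth v0 t' (p' j) by rewrite -tnth_nth tnth_mktuple (tnth_nth v0).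
rewrite (nthp _ p t (lift i k)) {1}pE lift_perm_lift nthp uE nth_omit ?sz //.
exact: (sz (permt p t) i).
Qed.

Lemma cochain_differential n f : is_cochain n f -> is_cochain n.+1 (differential f).
Proof.
move=> cf; split=> [y s ys|y t p].
  rewrite /differential; case: ifP => // /andP[yX yo].
  rewrite yo andbT inE yX /= in ys.
  rewrite big1 // => i _; rewrite (proj1 cf) ?raddf0 ?mul0rz //.
  apply/negP => /andP[/cells_card yn _].
  move: (ordering_mem yo (tnth (in_tuple s) i)); rewrite mem_tnth => yi.
  by rewrite (cardsD1 (tnth (in_tuple s) i)) -yi yn add1n eqxx in ys.
rewrite -/(permt p t).
have [/andP[yX yo]|H] := boolP ((y \in X) && ordering y t); last first.
  by rewrite /differential ordering_permt (negPf H) mul0rz.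
pose v0 := tnth t ord0.
rewrite !(@differentialE v0) ?ordering_permt // !size_tuple.
rewrite [in RHS](reindex_inj (@perm_inj _ p)) /= mulrz_suml; apply: eq_bigr => i _.
have [q pE] := lift_perm_surj p i.
have uP : size (omit t (p i)) == n by rewrite size_omit size_tuple.
rewrite /dterm (omit_permt v0 (u := Tuple uP) pE) //.
rewrite -[nth v0 (permt p t) i]tnth_nth tnth_mktuple (tnth_nth v0).
rewrite (cochain_alternating _ cf) /= raddfMz -!mulrzA; congr (_ *~ _).
(* The signs of [p] and [q] differ by [(-1)^(i + p i)], which exchanges the sign of term [i] for
   that of term [p i]. *)
have -> : odd_perm p = odd i (+) odd (p i) (+) odd_perm q :> bool by rewrite [in LHS]pE odd_lift_perm.
rewrite -(signr_odd _ i) -(signr_odd _ (p i)) -!signr_addb; congr (_ ^+ _).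
by case: (odd i); case: (odd (p i)); case: (odd_perm q).
Qed.

(** The map from [(i + 1, j)] to [(j, i)], for [j <= i], matches the entries below the diagonal with
    all the others: two vertices can be omitted in either order. *)
Lemma sum_simplicial_eq0 (V : zmodType) n (a : nat -> nat -> V) :
  (forall i j, (j <= i)%N -> (i < n)%N -> a i.+1 j = - a j i) ->
  \sum_(i < n.+1) \sum_(j < n) a i j = 0.
Proof.
move=> H.
rewrite (eq_bigr (fun i : 'I_n.+1 =>
    \sum_(j < n | (j < i)%N) a i j + \sum_(j < n | (i <= j)%N) a i j)); last first.
  move=> i _; rewrite (bigID (fun j : 'I_n => (j < i)%N)) /=; congr (_ + _).
  by apply: eq_bigl => j; rewrite -leqNgt.
rewrite big_split /= big_ord_recl /= big1 ?add0r => [|j]; last by rewrite ltn0.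
rewrite [X in _ + X]big_ord_recr /= [X in _ + (_ + X)]big1 ?addr0 => [|j]; last first.
  by rewrite leqNgt ltn_ord.
apply/eqP; rewrite addr_eq0 [X in _ == - X](exchange_big_dep xpredT) //= -sumrN; apply/eqP.
apply: eq_bigr => i _; rewrite -sumrN; apply: eq_big => [j|j ji]; first exact: ltnS.
by rewrite H.
Qed.

End Differential.

Section LinkCochains.
Variables (T : finType) (d : nat) (X : {set {set T}}) (F : augSheaf X).
Hypothesis HX : is_dcomplex d X.
Implicit Types (x y : {set T}) (t : seq T) (f h : cochain F).

Lemma omit_omit (s : seq T) i j : (j <= i)%N -> (i.+1 < size s)%N ->
  omit (omit s i.+1) j = omit (omit s j) i.
Proof.
move=> ji si; have v0 : T by case: s si.
have sj : (j < size s)%N by lia.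
apply: (@eq_from_nth _ v0) => [|k _].
  by rewrite !size_omit //; lia.
rewrite !nth_omit ?size_omit //; try lia.
congr nth; rewrite /bump; lia.
Qed.

Lemma differential_differential f y s : differential (differential f) y s = 0.
Proof.
rewrite [LHS]/differential; case: ifP => // /andP[yX yo].
case: s yo => [|v0 s'] yo; first by rewrite big_ord0.
set s := v0 :: s' in yo *; pose n := size s'.
pose G B o : F y := res F B y (f B o).
pose a i j := G (y :\ nth v0 s i :\ nth v0 s (bump i j)) (omit (omit s i) j) *~ ((-1) ^+ i * (-1) ^+ j).
rewrite (eq_bigr (fun i : 'I_n.+1 => \sum_(j < n) a i j)) => [|i _]; last first.
  rewrite (tnth_nth v0) /= -/s.
  have iy : nth v0 s i \in y by rewrite -(ordering_mem yo) mem_nth.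
  have yiX : y :\ nth v0 s i \in X by apply: (subface HX yX); apply: subD1set.
  have si : (i < size s)%N by [].
  rewrite (differentialE v0 _ yiX) ?ordering_omit // raddf_sum mulrz_suml size_omit //.
  apply: eq_bigr => j _; rewrite /dterm /a raddfMz -!mulrzA mulrC nth_omit //; congr (_ *~ _).
  have jy : nth v0 s (bump i j) \in y :\ nth v0 s i.
    by rewrite -nth_omit // -(ordering_mem (ordering_omit v0 yo si)) mem_nth // size_omit.
  rewrite /G (res_comp (y := y :\ nth v0 s i)) ?properD1 //.
  by apply: (subface HX yiX); apply: subD1set.
apply: sum_simplicial_eq0 => i j ji iN; rewrite /a omit_omit //.
have -> : bump i.+1 j = j by rewrite /bump; lia.
have -> : bump j i = i.+1 by rewrite /bump; lia.
rewrite -mulrNz; congr (_ *~ _); last by rewrite exprS mulN1r mulNr mulrC.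
by congr (G _ _); rewrite !setDDl setUC.
Qed.

Section OneFace.
Variables (z : {set T}) (s : seq T).
Hypothesis zs : ordering z s.
Local Notation LX := (link X z).
Local Notation LF := (link_sheaf F z).

(** The localisation of [f] at [z], a left inverse of the extension of [g] to [g^z]. The vertices of
    [z] come last, so that omitting a vertex of [x] has the same sign in the link as in [X]. *)
Definition link_cochain f : cochain LF :=
  fun x t => if [disjoint x & z] then f (x :|: z) (t ++ s) else (0 : F (x :|: z)).

Lemma link_cochainE f x t : [disjoint x & z] -> link_cochain f x t = f (x :|: z) (t ++ s).
Proof. by rewrite /link_cochain => ->. Qed.

Lemma cochain_link m f : is_cochain (m + #|z|) f -> is_cochain m (link_cochain f).
Proof.
move=> cf; split=> [x t xt|x t p]; rewrite /link_cochain; case: ifP => [dxz|_].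
- apply: (proj1 cf); apply: contraNN xt => /andP[xz xo].
  rewrite mem_link_cells xz dxz /=.
  by have := ordering_cat x t zs; rewrite dxz xo !andbT.
- by [].
- exact: (alternating_cat (ordering_size zs) (cochain_alternating _ cf)).
- by rewrite mul0rz.
Qed.

(** Terms omitting a vertex of [z] vanish by the hypothesis on [f]; the others omit a vertex at the
    same position of [t ++ s] as of [t]. *)
Lemma differential_link (v0 : T) f : (forall y t, ~~ (z \subset y) -> f y t = 0) ->
  differential (link_cochain f) = link_cochain (differential f).
Proof.
move=> f0; apply: cochain_ext => x t; rewrite /link_cochain [LHS]/differential.
have [dxz|dxz] := boolP [disjoint x & z]; last by rewrite mem_link (negPf dxz) andbF.
rewrite mem_link dxz andbT.
have xtE : ordering x t = ordering (x :|: z) (t ++ s).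
  by have := ordering_cat x t zs; rewrite dxz !andbT.
rewrite xtE; case: (boolP (_ && _)) => [/andP[xzX xto]|H]; last first.
  by rewrite /differential (negPf H).
rewrite (differentialE v0) // size_cat big_split_ord /= [X in _ = _ + X]big1 ?addr0; last first.
  move=> i _; rewrite /dterm f0 ?raddf0 ?mul0rz //.
  rewrite nth_cat ltnNge leq_addr /= addKn; apply/negP => /subsetP/(_ (nth v0 s i)).
  by rewrite -(ordering_mem zs) mem_nth // !inE eqxx => /(_ isT).
apply: eq_bigr => i _; rewrite /dterm (tnth_nth v0) /= nth_cat ltn_ord.
have tx : nth v0 t i \in x.
  by rewrite -xtE in xto; rewrite -(ordering_mem xto) mem_nth.
have tz : nth v0 t i \notin z by rewrite (disjointFr dxz tx).
have E : (x :|: z) :\ nth v0 t i = (x :\ nth v0 t i) :|: z.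
  rewrite setDUl; congr (_ :|: _); apply/setDidPl.
  by rewrite disjoint_sym disjoints1.
have oE : omit (t ++ s) i = omit t i ++ s.
  rewrite /omit take_cat drop_cat ltn_ord -catA; congr (_ ++ _).
  have := ltn_ord i; rewrite leq_eqVlt => /orP[/eqP it|->//].
  by rewrite it ltnn subnn drop0 drop_size.
have dx : [disjoint x :\ nth v0 t i & z].
  by apply: disjointWl dxz; apply: subD1set.
by rewrite E oE dx.
Qed.

Definition castF (a b : {set T}) (E : a = b) (v : F a) : F b :=
  ecast b (F b) E v.

Lemma castF_id (g : cochain LF) x x' (E : x' :|: z = x :|: z) : x' = x ->
  forall t, castF E (g x' t) = g x t.
Proof. by move=> xx; subst x' => t; rewrite (eq_irrelevance E erefl). Qed.

(** The value at the ordering [enum (y :\: z) ++ s] is prescribed by [g] and carried to the other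
    orderings by [relsign]. As [y :\: z :|: z] equals [y] only propositionally, it is transported
    along the equality that the match provides. *)
Definition extension m (g : cochain LF) : cochain F := fun y u =>
  if (y \in cells X (m + #|z|)) && ordering y u then
    if @eqP _ (y :\: z :|: z) y is ReflectT E then
      castF E (g (y :\: z) (enum (y :\: z)))
        *~ relsign (m + #|z|) u (enum (y :\: z) ++ s)
    else 0
  else 0.

Lemma extensionP m (g : cochain LF) : is_cochain m g -> is_extension s m g (extension m g).
Proof.
move=> cg; split.
- split=> [y u yu|y t p]; first by rewrite /extension (negPf yu).
  rewrite -/(permt p t) /extension ordering_permt; case: ifP => _; last by rewrite mul0rz.
  case: eqP => [E|_]; last by rewrite mul0rz.
  by rewrite (alternating_relsign _ t p) -[in LHS]mulrzl intz [in LHS]mulrC -mulrzA.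
- move=> x t xl xt; have := xl; rewrite mem_link_cells => /andP[xzm dxz].
  have xtE := ordering_cat x t zs.
  have xeE := ordering_cat x (enum x) zs.
  rewrite dxz !andbT in xtE xeE.
  rewrite /extension xzm -xtE xt /=.
  have xE : (x :|: z) :\: z = x by rewrite setDUl setDv setU0; apply/setDidPl.
  case: eqP => [E|]; last by rewrite xE.
  rewrite (castF_id g E xE) xE.
  have [u [p [uE tE]]] := orderings_permt (cells_card xl) xt (ordering_enum x).
  rewrite uE tE (cochain_alternating x cg); congr (_ *~ _).
  rewrite (alternating_cat (ordering_size zs) (@alternating_relsign _ _ _)).
  rewrite relsign_id.
  + by rewrite -mulrzl intz mulr1.
  + by rewrite -uE; move: xeE; rewrite ordering_enum => /esym/andP[].
  + by rewrite size_cat size_tuple (ordering_size zs).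
- move=> y t zy; rewrite /extension; case: ifP => // _; case: eqP => // E.
  by rewrite -E subsetUr in zy.
Qed.

Lemma link_extension m (g : cochain LF) h : is_cochain m g ->
  is_extension s m g h -> link_cochain h = g.
Proof.
move=> cg [ch hg _]; apply: cochain_ext => x t.
have [|xt] := boolP ((x \in cells LX m) && ordering x t).
  move=> /andP[xl xt]; rewrite link_cochainE ?hg //.
  by move: xl; rewrite mem_link_cells => /andP[].
by rewrite (proj1 cg) // (proj1 (cochain_link ch)).
Qed.

Lemma differential_off f : (forall y t, ~~ (z \subset y) -> f y t = 0) ->
  forall y t, ~~ (z \subset y) -> differential f y t = 0.
Proof.
move=> f0 y t zy; rewrite /differential; case: ifP => // _.
rewrite big1 // => i _; rewrite f0 ?raddf0 ?mul0rz //.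
by apply: contraNN zy => /subset_trans; apply; apply: subD1set.
Qed.

Lemma support_link m f x : is_cochain (m + #|z|) f -> [disjoint x & z] ->
  (x \in Defs.support m (link_cochain f)) = (x :|: z \in Defs.support (m + #|z|) f).
Proof.
move=> cf dxz; have := ordering_cat x (enum x) zs.
rewrite ordering_enum dxz !andbT => /esym xo.
by rewrite (mem_support (cochain_link cf) (ordering_enum x)) (mem_support cf xo) link_cochainE.
Qed.

Variable R : realType.
Hypotheses (zX : z \in X) (zd : (#|z| <= d)%N).
Local Notation w := (weight R d X).

Lemma norm_link m f : is_cochain (m + #|z|) f ->
  norm R (d - #|z|) m (link_cochain f)
  = (\sum_(y in Defs.support (m + #|z|) f | z \subset y) w y) / ('C(m + #|z|, #|z|)%:R * w z).
Proof.
move=> cf; have := @sum_weight_link R T d X HX z zX zd m (fun y => y \in Defs.support (m + #|z|) f).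
rewrite /norm /set_weight.
rewrite (_ : \sum_(y in cells X (m + #|z|) | _) _ = \sum_(y in Defs.support (m + #|z|) f | z \subset y) w y).
  move=> <-; apply: eq_bigl => x /=.
  apply/idP/andP => [xs|[xl xs]].
    have xl := support_cells xs; split=> //.
    by move: xl; rewrite mem_link_cells => /andP[_ dxz]; rewrite -support_link.
  by move: xl; rewrite mem_link_cells => /andP[_ dxz]; rewrite support_link.
apply: eq_bigl => y /=; rewrite andbC -andbA; apply/andP/andP => [[zy /andP[? _]]//|[ys zy]].
by split=> //; rewrite ys (support_cells ys).
Qed.

End OneFace.
End LinkCochains.

(** * Local minimality *)

Section SetWeight.
Variables (R : realType) (T : finType) (d : nat) (X : {set {set T}}).
Implicit Types A B : {set {set T}}.

Lemma set_weight_le A B : A \subset B ->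
  set_weight R d X A <= set_weight R d X B.
Proof.
move=> AB; rewrite /set_weight [leRHS](big_setID A) /= (setIidPr AB) lerDl.
by apply: sumr_ge0 => x _; apply: weight_ge0.
Qed.

Lemma set_weight_ge0 A : 0 <= set_weight R d X A.
Proof. by apply: sumr_ge0 => x _; apply: weight_ge0. Qed.

Lemma set_weightD A B : A \subset B ->
  set_weight R d X (B :\: A) = set_weight R d X B - set_weight R d X A.
Proof.
by move=> AB; rewrite /set_weight [in RHS](big_setID A) /= (setIidPr AB) addrAC subrr add0r.
Qed.

Lemma set_weightU A B : set_weight R d X (A :|: B) <= set_weight R d X A + set_weight R d X B.
Proof.
rewrite /set_weight (big_setID A) /= (setIidPr (subsetUl A B)) lerD2l.
by apply: set_weight_le; rewrite setDUl setDv set0U subsetDl.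
Qed.

End SetWeight.

Section LocalMinimality.
Variables (R : realType) (T : finType) (d : nat) (X : {set {set T}}) (F : augSheaf X).
Hypothesis HX : is_dcomplex d X.
Implicit Types (x y : {set T}) (t : seq T).
Local Notation w := (weight R d X).

Lemma norm_ge0 n (f : cochain F) : 0 <= norm R d n f.
Proof. exact: set_weight_ge0. Qed.

Lemma norm_le1 n (f : cochain F) : (n <= d.+1)%N -> norm R d n f <= 1.
Proof.
move=> nd; rewrite -(sum_weight_cells R HX nd); apply: set_weight_le.
by apply/subsetP => x /support_cells.
Qed.

Lemma mass_eq1 n : (n <= d.+1)%N ->
  (forall x, x \in cells X n -> nonzero_group (F x)) -> mass R d F n = 1.
Proof.
move=> nd Fn; rewrite -(sum_weight_cells R HX nd); apply: eq_bigl => x.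
by rewrite inE; case: (boolP (x \in cells X n)) => //= /Fn h; apply/asboolP.
Qed.

Section OneFace.
Variables (n : nat) (z : {set T}).
Hypotheses (nd : (n <= d)%N) (zX : z \in X) (z0 : (0 < #|z|)%N) (zn : (#|z| <= n)%N).
Let zd : (#|z| <= d)%N := leq_trans zn nd.
Let s := enum z.
Let zs : ordering z s := ordering_enum z.

Lemma mass_link_eq1 m : (m + #|z| <= d.+1)%N ->
  (forall x, x \in cells X (m + #|z|) -> nonzero_group (F x)) ->
  mass R (d - #|z|) (link_sheaf F z) m = 1.
Proof.
move=> md Fm; rewrite /mass /set_weight.
rewrite (eq_bigl (fun x => (x \in cells (link X z) m) && true)) => [|x].
  rewrite (sum_weight_link R HX zX zd m xpredT).
  under eq_bigl do rewrite andbT.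
  rewrite (sum_weight_over R HX) ?leq_addl // divff // mulf_neq0 //.
    by rewrite pnatr_eq0 -lt0n bin_gt0 leq_addl.
  by rewrite (weight_neq0 R HX).
rewrite inE andbT; case: (boolP (x \in cells _ m)) => //=.
rewrite mem_link_cells => /andP[/Fm h _]; exact/asboolP.
Qed.

(** A correction [d(g^z)] changes [f] only at faces containing [z]. Cancelling the other faces from
    the inequality of local minimality leaves, up to a constant factor, the inequality in the
    link. *)
Lemma link_locally_minimal (f : cochain F) b : is_cochain n f -> locally_minimal R d n f ->
  is_coboundary (n - #|z|) b ->
  norm R (d - #|z|) (n - #|z|) (link_cochain z s f)
  <= norm R (d - #|z|) (n - #|z|) (cochain_add (link_cochain z s f) b).
Proof.
move=> cf fmin; case E : (n - #|z|)%N => [|m].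
  (* Here [z] has [n] vertices, a case which local minimality does not cover; but at the empty face
     of the link the only coboundary is 0. *)
  move=> b0; suff -> : cochain_add (link_cochain z s f) b = link_cochain z s f by [].
  by apply: cochain_ext => x t; rewrite /cochain_add b0 addr0.
move=> [g cg /cochain_ext ->].
have mE : (n.-1 - #|z| = m)%N by lia.
have nE : n = (m.+1 + #|z|)%N by lia.
pose h := extension s m g.
have hext := extensionP zs cg.
have [ch _ hoff] := hext.
have /card_gt0P[v0 _] := z0.
have : norm R d n f <= norm R d n (cochain_add f (differential h)).
  have := fmin z s zX _ zs g h; rewrite mE => /(_ _ cg hext); apply.
  by rewrite z0; lia.
have cdh : is_cochain n (differential h) by rewrite nE addSn; exact: (cochain_differential ch).
have cfdh := cochainD cf cdh.
rewrite -(link_extension zs cg hext) (differential_link zs v0 hoff).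
have -> : cochain_add (link_cochain z s f) (link_cochain z s (differential h))
    = link_cochain z s (cochain_add f (differential h)).
  apply: cochain_ext => x t; rewrite /cochain_add /link_cochain.
  by case: ifP => // _; rewrite addr0.
rewrite nE in cf cfdh *; rewrite !(norm_link HX zs R zX zd) //.
rewrite ler_pM2r; last first.
  rewrite invr_gt0 mulr_gt0 ?(weight_gt0 R HX) //.
  by rewrite ltr0n bin_gt0 leq_addl.
rewrite /norm /set_weight (bigID (fun y => z \subset y)) /=.
rewrite [X in _ <= X -> _](bigID (fun y => z \subset y)) /=.
rewrite [X in _ + X](eq_bigl (fun y =>
    (y \in Defs.support (m.+1 + #|z|) (cochain_add f (differential h)))
    && ~~ (z \subset y))); last first.
  move=> y; have [zy|zy] := boolP (z \subset y); first by rewrite !andbF.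
  rewrite !andbT (mem_support cf (ordering_enum y)) (mem_support cfdh (ordering_enum y)).
  by rewrite /cochain_add (differential_off hoff _ zy) addr0.
by rewrite lerD2r.
Qed.

(** Restricting lowers the norm by exactly the weight of the removed faces, while it lowers the norm
    after adding [b] by at most that weight. *)
Lemma link_restriction_minimal (f : cochain F) (L : {set {set T}}) b :
  is_cochain n f -> locally_minimal R d n f -> is_coboundary (n - #|z|) b ->
  norm R (d - #|z|) (n - #|z|) (link_cochain z s (restr L f))
  <= norm R (d - #|z|) (n - #|z|) (cochain_add (link_cochain z s (restr L f)) b).
Proof.
move=> cf fmin bb; have := link_locally_minimal cf fmin bb.
set m := (n - #|z|)%N.
set f0 := link_cochain z s f; set f1 := link_cochain z s (restr L f).
rewrite /norm /set_weight => le0.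
have f01 x : f1 x (enum x) = f0 x (enum x) \/ f1 x (enum x) = 0.
  rewrite /f1 /f0 /link_cochain /restr; case: ifP => _; last by left.
  by case: ifP => _; [left | right].
have sub10 : Defs.support m f1 \subset Defs.support m f0.
  apply/subsetP => x; rewrite !mem_supportE; case: (f01 x) => [->//|-> /andP[_]].
  by rewrite eqxx.
have sub : Defs.support m (cochain_add f0 b) \subset
    Defs.support m (cochain_add f1 b) :|: (Defs.support m f0 :\: Defs.support m f1).
  apply/subsetP => x; rewrite in_setU in_setD !mem_supportE /cochain_add.
  case: (x \in cells (link X z) m) => //= H.
  have [->|->] := f01 x; first by rewrite H.
  rewrite add0r eqxx /=; apply: contraTT H; rewrite negb_or !negbK => /andP[/eqP-> /eqP->].
  by rewrite addr0.
have := le_trans le0 (le_trans (set_weight_le R _ _ sub) (set_weightU R _ _ _ _)).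
by rewrite set_weightD // /set_weight; lra.
Qed.

(* A restriction of a minimal cochain is minimal, which allows the expansion
   of the link to be applied to the part of [f] supported on [L]. *)
Lemma local_expansion (f : cochain F) (L : {set {set T}}) (e : R) :
  is_cochain n f -> locally_minimal R d n f ->
  L \subset Defs.support n f -> (forall x, x \in L -> z \subset x) ->
  (forall x, x \in cells X n -> nonzero_group (F x)) ->
  (forall x, x \in cells X n.+1 -> nonzero_group (F x)) ->
  0 <= e ->
  coboundary_expander (d - #|z|) (link_sheaf F z) (n - #|z|) (e * (n.+1 - #|z|)%:R / n.+1%:R) ->
  e * set_weight R d X L <= norm R d n.+1 (differential (restr L f)).
Proof.
move=> cf fmin Lsupp Lz Fn Fn1 e0 exp.
have cL := restr_cochain L cf.
have /card_gt0P[v0 _] := z0.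
have Loff y t : ~~ (z \subset y) -> restr L f y t = 0.
  by rewrite /restr; case: ifP => // /Lz ->.
have nE : n = (n - #|z| + #|z|)%N by rewrite subnK.
have cLz : is_cochain (n - #|z|) (link_cochain z s (restr L f)).
  by apply: cochain_link => //; rewrite -nE.
have [b [bb _]] := exp _ cLz.
have cdL := cochain_differential cL.
have nE1 : n.+1 = ((n - #|z|).+1 + #|z|)%N by rewrite addSn -nE.
rewrite !mass_link_eq1 -?nE1 -?nE ?mulr1 //; last exact: leq_trans nd _.
rewrite (differential_link zs v0 Loff) norm_link -?nE1 // => H.
have le1 := link_restriction_minimal L cf fmin bb.
have suppL : Defs.support n (restr L f) = L.
  apply/setP => x; rewrite in_set /restr; case: (boolP (x \in L)) => xL; last by rewrite eqxx andbF.
  by have := subsetP Lsupp x xL; rewrite in_set.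
rewrite norm_link -?nE // suppL in le1.
move: H; set D := \sum_(y in Defs.support n.+1 _ | _) _ => H.
have DE : D = norm R d n.+1 (differential (restr L f)).
  apply: eq_bigl => y; have [zy|zy] := boolP (z \subset y); first by rewrite andbT.
  by rewrite (mem_support cdL (ordering_enum y)) (differential_off Loff _ zy) eqxx.
have LE : \sum_(y in L | z \subset y) w y = set_weight R d X L.
  apply: eq_bigl => y; by have [/Lz->|] := boolP (y \in L).
rewrite LE in le1; rewrite -DE.
have e1 : 0 <= e * (n.+1 - #|z|)%:R / n.+1%:R by rewrite divr_ge0 ?mulr_ge0.
have {H le1} := le_trans (ler_wpM2l e1 le1) H.
(* The norms in the link carry the factors ['C(n.+1, #|z|)] and ['C(n, #|z|)], whose ratio is
   compensated by [(n.+1 - #|z|) / n.+1]. For [n = k + 1] and [#|z| = i + 1], this is where the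
   fractions [(k + 2) / (k + 1 - i)] of the theorem come from. *)
have bE : ((n.+1 - #|z|) * 'C(n.+1, #|z|) = n.+1 * 'C(n, #|z|))%N.
  by rewrite -mul_bin_down.
have {bE} := congr1 (fun i => i%:R : R) bE; rewrite !natrM.
have wz := weight_gt0 R HX zX.
have c1 : 0 < 'C(n.+1, #|z|)%:R :> R by rewrite ltr0n bin_gt0 leqW.
have c2 : 0 < 'C(n, #|z|)%:R :> R by rewrite ltr0n bin_gt0.
have n0 : 0 < n.+1%:R :> R by rewrite ltr0n.
move: (set_weight R d X L) wz c1 c2 n0; move: ('C(n.+1, _)%:R : R) ('C(n, _)%:R : R) (n.+1%:R : R).
move: (w z) => v p q r u v0' p0 q0 r0 E.
rewrite ler_pdivlMr ?mulr_gt0 // => H; apply: le_trans H.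
rewrite le_eqVlt; apply/orP; left; apply/eqP.
transitivity (e * u * ((n.+1 - #|z|)%:R * p) / (r * q)); last by field; rewrite !gt_eqF.
by rewrite E; field; rewrite !gt_eqF.
Qed.

End OneFace.
End LocalMinimality.

(** * Fat faces *)

Section FatFaces.
Variables (R : realType) (T : finType) (d : nat) (X : {set {set T}}).
Hypothesis HX : is_dcomplex d X.
Variables (n : nat) (S : {set {set T}}) (eta : R).
Hypotheses (SX : S \subset cells X n) (eta0 : 0 <= eta).
Implicit Types (x y z u : {set T}) (v : T).
Local Notation w := (weight R d X).
Local Notation wt := (set_weight R d X).

(* [fat_level j] consists of faces with [n - j] vertices. *)
Fixpoint fat_level (j : nat) : {set {set T}} :=
  if j is i.+1 then
    [set z in cells X (n - i.+1) |
      eta ^+ (2 ^ i) * ((n - i)%:R * w z) <= \sum_(x in fat_level i | z \subset x) w x]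
  else S.

Definition fat : {set {set T}} :=
  [set x in X | (#|x| <= n)%N && (x \in fat_level (n - #|x|))].

Lemma fat_level_cells j : fat_level j \subset cells X (n - j).
Proof.
case: j => [|j]; first by rewrite subn0.
by apply/subsetP => z; rewrite in_set => /andP[].
Qed.

Lemma fat_face x : x \in fat -> x \in X.
Proof. by rewrite in_set => /andP[]. Qed.

Lemma fat_card x : x \in fat -> (#|x| <= n)%N.
Proof. by rewrite in_set => /and3P[]. Qed.

Lemma fat_top x : (#|x| == n) && (x \in fat) = (x \in S).
Proof.
apply/andP/idP => [[/eqP xn]|xS].
  by rewrite in_set xn subnn => /and3P[].
have := subsetP SX x xS; rewrite inE => /andP[xX /eqP xn].
by rewrite in_set xX xn leqnn subnn xS eqxx.
Qed.

Lemma sum_subfaces m (A : {set {set T}}) : A \subset cells X m.+1 ->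
  \sum_(z in cells X m) \sum_(x in A | z \subset x) w x = m.+1%:R * wt A.
Proof.
move=> AX; rewrite (exchange_big_dep (mem A)) /=; last by move=> z x _ /andP[].
rewrite /set_weight mulr_sumr; apply: eq_bigr => x xA.
have := subsetP AX x xA; rewrite inE => /andP[xX /eqP xm].
rewrite sumr_const -[LHS]mulr_natl; congr (_%:R * _).
rewrite -(binSn m) -xm -cards_draws; apply: eq_card => z.
rewrite [RHS]inE; change ([&& z \in cells X m, x \in A & z \subset x] = (z \subset x) && (#|z| == m)).
rewrite xA inE; case: (boolP (z \subset x)) => [zx|]; last by rewrite !andbF.
by rewrite (subface HX xX zx) !andbT.
Qed.

(** Markov's inequality: summing the defining condition over level [j + 1] counts each face of level
    [j] at most once for each of its [n - j] facets. *)
Lemma fat_levelS_weight j : (j < n)%N ->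
  eta ^+ (2 ^ j) * wt (fat_level j.+1) <= wt (fat_level j).
Proof.
move=> jn; have nj0 : 0 < (n - j)%:R :> R by rewrite ltr0n subn_gt0.
rewrite -(ler_pM2l nj0).
have njE : (n - j = (n - j.+1).+1)%N by rewrite subnS prednK // subn_gt0.
have := fat_level_cells j; rewrite [X in cells X]/= => AX.
rewrite [in leRHS]njE -sum_subfaces -?njE //.
rewrite (bigID (mem (fat_level j.+1))) /= -[leLHS]addr0; apply: lerD; last first.
  by apply: sumr_ge0 => z _; apply: sumr_ge0 => x _; apply: weight_ge0.
rewrite mulrCA /set_weight !mulr_sumr [leRHS](eq_bigl (mem (fat_level j.+1))) => [|z]; last first.
  by rewrite andb_idl // => zA; have := subsetP (fat_level_cells j.+1) z zA.
by apply: ler_sum => z; rewrite in_set => /andP[].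
Qed.

Lemma fat_level_weight j : (j <= n)%N -> eta ^+ (2 ^ j - 1) * wt (fat_level j) <= wt S.
Proof.
elim: j => [|j IH] jn; first by rewrite subnn expr0 mul1r.
apply: le_trans (IH (ltnW jn)).
have -> : (2 ^ j.+1 - 1 = (2 ^ j - 1) + 2 ^ j)%N.
  by have := expn_gt0 2 j; rewrite expnS; lia.
by rewrite exprD -mulrA ler_wpM2l ?exprn_ge0 // fat_levelS_weight.
Qed.

(** The empty face alone has weight 1, so if it were fat, then [fat_level_weight] at level [n] would
    bound [wt S] from below. *)
Lemma set0_notin_fat : wt S < eta ^+ (2 ^ n - 1) -> set0 \notin fat.
Proof.
move=> small; apply/negP; rewrite in_set cards0 subn0 => /and3P[_ _ f0].
have := fat_level_weight (leqnn n); apply/negP; rewrite -ltNge.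
apply: lt_le_trans small _; rewrite ler_peMr ?exprn_ge0 //.
rewrite -(weight0 R HX) /set_weight (bigD1 set0) //= lerDl.
by apply: sumr_ge0 => x _; apply: weight_ge0.
Qed.

Variable lambda : R.
Hypotheses (n0 : (0 < n)%N) (nd : (n <= d)%N).
Hypotheses (lambda0 : 0 <= lambda) (lambda_eta : lambda <= eta ^+ (2 ^ n.-1)).
Hypothesis gapX : forall z, z \in X -> (#|z| < n)%N -> spectral_gap (link_graph R d X z) lambda.

Definition fat_nbrs u : {set T} := [set v | (v \notin u) && (v |: u \in fat)].

Lemma sum_fat_nbrs u : (#|u| < n)%N ->
  \sum_(v in fat_nbrs u) w (v |: u)
  = \sum_(x in fat_level (n - #|u|.+1) | u \subset x) w x.
Proof.
move=> un; rewrite -(@big_imset _ _ _ _ _ (fun v => v |: u) _ w) /=; last first.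
  move=> v v' _; rewrite inE => /andP[v'u _] /setP/(_ v').
  by rewrite !inE eqxx (negPf v'u) orbF /= => /eqP.
apply: eq_bigl => x; apply/imsetP/andP.
  move=> [v]; rewrite inE => /andP[vu]; rewrite in_set cardsU1 vu add1n => /and3P[_ _ H] ->.
  by rewrite H subsetUr.
move=> [xA ux]; have := subsetP (fat_level_cells _) x xA; rewrite subKn //.
rewrite inE => /andP[xX /eqP xu].
have /cards1P[v xv] : #|x :\: u| == 1%N by rewrite cardsD (setIidPr ux) xu subSnn.
have vxu : v \in x :\: u by rewrite xv set11.
have xE : x = v |: u by rewrite -xv setUC setDE setUIr setUCr setIT (setUidPr ux).
exists v => //; rewrite inE -xE in_set xX xu un xA.
by move: vxu; rewrite inE => /andP[->].
Qed.

Lemma sum_degree_fat_nbrs u : (#|u| < n)%N ->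
  \sum_(v in fat_nbrs u) degree (link_graph R d X u) v
  = #|u|.+2%:R * \sum_(v in fat_nbrs u) w (v |: u).
Proof.
move=> un; rewrite mulr_sumr; apply: eq_bigr => v; rewrite inE => /andP[vu _].
by rewrite (degree_link_graph R HX) ?(leq_trans un) // (negPf vu).
Qed.

(* If eta >= 1 the bound is trivial; otherwise it follows from the mixing
   lemma, since a face which is not fat has few fat neighbours. *)
Lemma fat_edges u : u \in X -> (#|u| < n)%N -> u \notin fat ->
  \sum_(v in fat_nbrs u) \sum_(v' in fat_nbrs u) link_graph R d X u v v'
  <= 2 * eta ^+ (2 ^ (n - #|u|.+1)) * (#|u|.+2%:R * \sum_(v in fat_nbrs u) w (v |: u)).
Proof.
move=> uX un ufat; rewrite -sum_degree_fat_nbrs //.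
set K := link_graph R d X u; set A := fat_nbrs u; set j := (n - _)%N.
have Ksym : forall v v', K v v' = K v' v by exact: link_graph_sym.
have K0 : forall v v', 0 <= K v v' by exact: link_graph_ge0.
set r := \sum_(v in A) degree K v.
have r0 : 0 <= r by apply: sumr_ge0 => v _; apply: (degree_ge0 K0).
have [eta1|eta1] := leP 1 eta.
  apply: (@le_trans _ _ r).
    apply: ler_sum => v _; rewrite /degree [leRHS](bigID (mem A)) /= lerDl.
    by apply: sumr_ge0.
  rewrite ler_peMl //; have := exprn_ege1 (2 ^ j) eta1; lra.
(* As [eta < 1] and [j <= n - 1], the power assumed to bound [lambda] is the smallest of all
   thresholds. *)
have lam : lambda <= eta ^+ (2 ^ j).
  apply: le_trans lambda_eta _; apply: ler_wiXn2l => //; first exact: ltW.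
  by rewrite leq_exp2l // /j; lia.
apply: le_trans (mixing Ksym K0 A lambda0 (gapX uX un)) _.
rewrite -/r (sum_degree_link_graph R HX) ?(leq_trans un) //.
rewrite (_ : 2 * _ * r = eta ^+ (2 ^ j) * r + eta ^+ (2 ^ j) * r); last by ring.
apply: lerD.
  rewrite expr2 -mulrA [leLHS]mulrC; apply: ler_wpM2r => //.
  have wu := weight_gt0 R HX uX.
  have rE : r = #|u|.+2%:R * \sum_(v in A) w (v |: u) := sum_degree_fat_nbrs un.
  rewrite ler_pdivrMr; last by do 2 (apply: mulr_gt0; first by rewrite ltr0n).
  rewrite rE [leRHS]mulrCA ler_pM2l ?ltr0n //.
  rewrite /A sum_fat_nbrs //; move: ufat; rewrite in_set uX (ltnW un) /=.
  have -> : (n - #|u| = j.+1)%N by rewrite /j; lia.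
  rewrite [X in _ \notin X]/= in_set.
  have -> : u \in cells X (n - j.+1) by rewrite inE uX /j; apply/eqP; lia.
  have -> : (n - j = #|u|.+1)%N by rewrite /j; lia.
  by rewrite -/j /= -ltNge => /ltW.
by rewrite ler_wpM2r.
Qed.

(* A face with n + 1 vertices is bad if two fat faces of the same dimension
   in it meet in a face of codimension 1 which is not fat. *)
Definition bad_faces : {set {set T}} :=
  [set y in cells X n.+1 | [exists u : {set T}, [exists v in fat_nbrs u, [exists v' in fat_nbrs u,
     [&& v != v', v |: (v' |: u) \subset y & u \notin fat]]]]].

Lemma sum_fat_nbrs_cells m : (m < n)%N ->
  \sum_(u in cells X m) \sum_(v in fat_nbrs u) w (v |: u)
  = m.+1%:R * wt (fat_level (n - m.+1)).
Proof.
move=> mn; rewrite -sum_subfaces; last first.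
  by have := fat_level_cells (n - m.+1); rewrite subKn.
by apply: eq_bigr => u /cells_card um; rewrite sum_fat_nbrs um.
Qed.

(** Union bound over the witnesses [u], [v], [v']; the binomial is the total weight of the faces
    with [n + 1] vertices over [v |: (v' |: u)], relative to the weight of that set. *)
Lemma bad_faces_union :
  wt bad_faces <= \sum_(u in X | (#|u| < n)%N && (u \notin fat))
    'C(n.+1, #|u|.+2)%:R
      * \sum_(v in fat_nbrs u) \sum_(v' in fat_nbrs u) link_graph R d X u v v'.
Proof.
pose P u v v' y := [&& v != v' & v |: (v' |: u) \subset y].
apply: (@le_trans _ _ (\sum_(y in cells X n.+1)
   \sum_(u in X | (#|u| < n)%N && (u \notin fat)) \sum_(v in fat_nbrs u) \sum_(v' in fat_nbrs u)
     (P u v v' y)%:R * w y)).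
  have pos y u v v' : 0 <= (P u v v' y)%:R * w y by rewrite mulr_ge0 ?weight_ge0.
  rewrite [leRHS](bigID (mem bad_faces)) /= -[leLHS]addr0; apply: lerD; last first.
    apply: sumr_ge0 => y _; apply: sumr_ge0 => u _.
    by apply: sumr_ge0 => v _; apply: sumr_ge0 => v' _.
  rewrite [leRHS](eq_bigl (mem bad_faces)) => [|y]; last first.
    by rewrite andb_idl // in_set => /andP[].
  apply: ler_sum => y; rewrite in_set => /andP[yn].
  case/existsP=> u /exists_inP[v vu /exists_inP[v' v'u /and3P[vv' sub ufat]]].
  have [vn v'n] : v \notin u /\ v' \notin u.
    by move: vu v'u; rewrite !in_set => /andP[-> _] /andP[-> _].
  have yX := cells_face yn.
  have uX : u \in X.
    apply: (subface HX yX); apply: subset_trans sub.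
    by rewrite setUA subsetUr.
  have un : (#|u| < n)%N.
    have := subset_leq_card sub; rewrite (cells_card yn) !cardsU1 v'n !inE negb_or vv' vn /=.
    by rewrite !add1n ltnS.
  rewrite (bigD1 u) /=; last by rewrite uX un.
  have Py : P u v v' y by rewrite /P vv' sub.
  rewrite (bigD1 v) //= (bigD1 v') //= Py mul1r -!addrA lerDl.
  by repeat apply: addr_ge0; repeat (apply: sumr_ge0 => ? _); apply: pos.
rewrite exchange_big /=; apply: ler_sum => u /and3P[uX un ufat].
rewrite exchange_big mulr_sumr /=; apply: ler_sum => v; rewrite in_set => /andP[vu _].
rewrite exchange_big mulr_sumr /=; apply: ler_sum => v'; rewrite in_set => /andP[v'u _].
rewrite /link_graph vu v'u /P andbT; have [->|vv'] /= := eqVneq v v'.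
  by rewrite mulr0 big1 // => y _; rewrite mul0r.
have card : #|v |: (v' |: u)| = #|u|.+2 by rewrite !cardsU1 v'u !inE negb_or vv' vu.
have := sum_weight_over R HX (m := n.+1) (x := v |: (v' |: u)).
rewrite card => <- //; rewrite [leRHS]big_mkcondr /=; apply: ler_sum => y _.
by case: ifP; rewrite ?mul1r ?mul0r.
Qed.

(** For [#|u| = m] and [j = n - m - 1], the proportion [2 * eta ^+ (2 ^ j)] of fat edges meets the
    bound [eta ^+ (2 ^ j - 1) * wt (fat_level j) <= wt S]. One factor [eta] is left over in every
    dimension, and only binomials depend on [m]. *)
Lemma bad_faces_weight :
  wt bad_faces <= 2 * (n.+1%:R * n%:R * 2 ^+ n.-1) * eta * wt S.
Proof.
apply: le_trans bad_faces_union _.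
have fw u v : 0 <= w (v |: u) by apply: weight_ge0.
apply: (@le_trans _ _ (\sum_(m < n) \sum_(u in cells X m)
   'C(n.+1, m.+2)%:R * (2 * eta ^+ (2 ^ (n - m.+1)) * (m.+2%:R * \sum_(v in fat_nbrs u) w (v |: u))))).
  rewrite (exchange_big_dep (mem X)) /=; last by move=> m u _; apply: cells_face.
  rewrite big_mkcondr /=; apply: ler_sum => u uX.
  have term0 m : 0 <= 'C(n.+1, m.+2)%:R * (2 * eta ^+ (2 ^ (n - m.+1)) *
         (m.+2%:R * \sum_(v in fat_nbrs u) w (v |: u))).
    by rewrite !mulr_ge0 ?exprn_ge0 ?ler0n // sumr_ge0.
  case: ifP => [/andP[un ufat]|_]; last by apply: sumr_ge0.
  rewrite (bigD1 (Ordinal un)) /=; last by rewrite inE uX eqxx.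
  apply: ler_wpDr; first by apply: sumr_ge0.
  by rewrite ler_wpM2l // fat_edges.
(* Absorbing both factors into the binomial leaves ['C(n.-1, m)], whose sum over [m] is
   [2 ^ n.-1]. *)
have binE m : (m < n)%N -> 'C(n.+1, m.+2)%:R * m.+2%:R * m.+1%:R = n.+1%:R * n%:R * 'C(n.-1, m)%:R :> R.
  move=> mn; rewrite -!natrM; congr (_%:R).
  have h1 := mul_bin_diag n.+1 m.+1; have h2 := mul_bin_diag n m.
  rewrite /= in h1 h2.
  by rewrite [('C(n.+1, _) * _)%N]mulnC -h1 -mulnA [('C(n, _) * _)%N]mulnC -h2 mulnA.
apply: (@le_trans _ _ (\sum_(m < n) (n.+1%:R * n%:R * 'C(n.-1, m)%:R) * (2 * eta * wt S))).
  apply: ler_sum => m _; have mn := ltn_ord m.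
  rewrite -!mulr_sumr sum_fat_nbrs_cells // -binE //.
  have := fat_level_weight (leq_subr m.+1 n); set j := (n - m.+1)%N.
  have -> : eta ^+ (2 ^ j) = eta * eta ^+ (2 ^ j - 1).
    by rewrite -exprS -subSn ?expn_gt0 // subSS subn0.
  move=> H.
  rewrite [leLHS](_ : _ = 'C(n.+1, m.+2)%:R * m.+2%:R * m.+1%:R
     * (2 * eta * (eta ^+ (2 ^ j - 1) * wt (fat_level j)))); last by ring.
  rewrite ler_wpM2l ?mulr_ge0 ?ler0n // ler_wpM2l // mulr_ge0 //.
rewrite -mulr_suml -mulr_sumr (_ : \sum_(m < n) 'C(n.-1, m)%:R = 2 ^+ n.-1).
  rewrite le_eqVlt; apply/orP; left; apply/eqP; ring.
rewrite -natrX -[2%N]/(1 + 1)%N expnDn prednK // natr_sum.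
by apply: eq_bigr => m _; rewrite !exp1n !muln1.
Qed.

End FatFaces.

(** * Ladders *)

Section Ladders.
Variables (T : finType) (A : {set {set T}}).
Implicit Types (x y z u : {set T}) (v : T).

Definition rung : rel {set T} :=
  [rel x z | [&& x \in A, z \in A & [exists v in x, z == x :\ v]]].

Definition terminal z := (z \in A) && [forall v in z, z :\ v \notin A].

Definition ends x : {set {set T}} := [set z | connect rung x z && terminal z].

(** The choice depends on the set [ends x] only, so faces with the same ends get the same root. The
    default [set0] occurs only for [x] outside [A]. *)
Definition root_face x : {set T} := odflt set0 [pick z in ends x].

Definition good_face y := forall u v v', v != v' -> v \notin u -> v' \notin u ->
  v |: (v' |: u) \subset y -> v |: u \in A -> v' |: u \in A -> u \in A.

Lemma rungD1 x v : x \in A -> v \in x -> x :\ v \in A -> rung x (x :\ v).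
Proof. by move=> xA vx zA; rewrite /rung /= xA zA; apply/exists_inP; exists v. Qed.

Lemma ladder_sub x z : connect rung x z -> z \subset x.
Proof.
case/connectP => p pth ->; elim: p x pth => //= u p IH x /andP[/and3P[_ _ /exists_inP[v _ /eqP uE]] pth].
by apply: subset_trans (IH _ pth) _; rewrite uE subD1set.
Qed.

Lemma ends_neq0 x : x \in A -> exists z, z \in ends x.
Proof.
have [m] := ubnP #|x|; elim: m x => // m IH x; rewrite ltnS => xm xA.
have [tx|] := boolP (terminal x); first by exists x; rewrite inE connect0.
rewrite /terminal xA /= negb_forall_in => /exists_inP[v vx]; rewrite negbK => zA.
have [|z] := IH (x :\ v) _ zA.
  by apply: leq_trans xm; rewrite [in leqRHS](cardsD1 v) vx.
rewrite inE => /andP[xz tz]; exists z; rewrite inE tz andbT.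
by apply: connect_trans (connect1 _) xz; apply: rungD1.
Qed.

Lemma root_ends x : x \in A -> root_face x \in ends x.
Proof.
move=> /ends_neq0[z zx]; rewrite /root_face; case: pickP => //= none.
by rewrite none in zx.
Qed.

Lemma root_faceP x : x \in A -> [/\ root_face x \in A & root_face x \subset x].
Proof.
by move=> /root_ends; rewrite inE => /andP[/ladder_sub ? /andP[]].
Qed.

Lemma good_ladder y x x' v z : good_face y -> x \in A -> x' \in A ->
  x = y :\ v -> v \in y -> x' \subset y -> (#|x'| < #|y|)%N -> (#|y| <= #|x'|.+1)%N ->
  connect rung x' z ->
  if v \in z then z :\ v \in A /\ connect rung x (z :\ v) else connect rung x z.
Proof.
move=> good xA x'A xE vy x'y x'ly yx'.
have base : if v \in x' then x' :\ v \in A /\ connect rung x (x' :\ v) else connect rung x x'.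
  have [vx'|vx'] := boolP (v \in x'); last first.
    suff -> : x' = x by rewrite connect0.
    apply/eqP; rewrite eqEcard; apply/andP; split.
      by rewrite xE subsetD1 x'y.
    by rewrite -ltnS xE; apply: leq_trans yx'; rewrite [in leqRHS](cardsD1 v) vy.
  have /cards1P[v' v'E] : #|y :\: x'| == 1%N.
    by rewrite cardsD (setIidPr x'y); apply/eqP; lia.
  have /setDP[v'y v'x'] : v' \in y :\: x' by rewrite v'E set11.
  have vv' : v != v' by apply: contraTneq vx' => ->.
  have yE : y = v' |: x'.
    by rewrite -v'E setUC setDE setUIr setUCr setIT (setUidPr x'y).
  have x'E : v |: (x' :\ v) = x' by rewrite setD1K.
  have xE' : v' |: (x' :\ v) = x.
    rewrite xE yE; apply/setP => t; rewrite !inE.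
    by have [->|] := eqVneq t v'; rewrite //= eq_sym vv'.
  have uA : x' :\ v \in A.
    apply: (good (x' :\ v) v v' vv'); rewrite ?x'E ?xE' ?inE ?eqxx ?negb_and ?v'x' ?orbT //.
    by rewrite xE setD1K.
  split=> //; apply: connect1; rewrite -[in X in rung _ X](_ : x :\ v' = x' :\ v).
    apply: rungD1 => //.
      by rewrite -xE' setU11.
    by rewrite -xE' setU1K // !inE negb_and v'x' orbT.
  by rewrite -xE' setU1K // !inE negb_and v'x' orbT.
case/connectP => p.
elim: p x' {yx' x'ly} x'A x'y base => [|z1 p IH] x' x'A x'y base; first by move=> _ ->.
move=> /= /andP[/and3P[_ z1A /exists_inP[a ax' /eqP z1E]] pth zE].
apply: (IH z1) => //; first by apply: subset_trans x'y; rewrite z1E subD1set.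
have [vz1|vz1] := boolP (v \in z1).
  have : (a != v) && (v \in x') by move: vz1; rewrite z1E !inE eq_sym.
  move=> /andP[av vx']; rewrite vx' in base; case: base => x'vA xx'v.
  have uE : z1 :\ v = (x' :\ v) :\ a by rewrite z1E !setDDl setUC.
  have uA : z1 :\ v \in A.
    apply: (good _ a v av); rewrite ?setD1K //.
    - by rewrite uE !inE eqxx.
    - by rewrite !inE eqxx.
    - by rewrite z1E setD1K.
    - by rewrite uE setD1K // !inE av.
  split=> //; apply: connect_trans xx'v (connect1 _).
  by rewrite uE; apply: rungD1; rewrite -?uE // !inE av.
have [vx'|vx'] := boolP (v \in x'); rewrite ?vx' ?(negPf vx') in base.
  suff -> : z1 = x' :\ v by case: base.
  rewrite z1E; congr (_ :\: [set _]).
  by move: vz1; rewrite z1E !inE vx' andbT negbK eq_sym => /eqP.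
apply: connect_trans base (connect1 _).
by rewrite z1E; apply: rungD1; rewrite -?z1E.
Qed.

(** An end [z] of a ladder from one facet is an end for the other: if it contained the vertex [v]
    missing from the latter, then [z :\ v] would be in [A] and [z] not terminal. So both facets have
    the same ends. *)
Lemma good_root y x x' : good_face y -> x \in A -> x' \in A ->
  x \subset y -> x' \subset y -> #|x| = #|x'| -> #|y| = #|x|.+1 ->
  root_face x = root_face x'.
Proof.
move=> good; suff sub x1 x2 : x1 \in A -> x2 \in A -> x1 \subset y -> x2 \subset y ->
    #|x1| = #|x2| -> #|y| = #|x1|.+1 -> ends x2 \subset ends x1.
  move=> xA x'A xy x'y cx cy; rewrite /root_face.
  suff -> : ends x = ends x' by [].
  by apply/eqP; rewrite eqEsubset !sub // -cx.
move=> x1A x2A x1y x2y cx cy; apply/subsetP => z; rewrite !inE => /andP[x2z tz].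
have /cards1P[v vE] : #|y :\: x1| == 1%N by rewrite cardsD (setIidPr x1y) cy subSnn.
have /setDP[vy vx1] : v \in y :\: x1 by rewrite vE set11.
have x1E : x1 = y :\ v by rewrite -vE setDDr setDv set0U (setIidPr x1y).
have := good_ladder good x1A x2A x1E vy x2y; rewrite -cx cy => /(_ _ (leqnn _) (leqnn _) x2z).
case: ifP => [vz [zvA _]|_ ->]; last by [].
by move: tz; rewrite /terminal => /andP[_ /forall_inP/(_ v vz)]; rewrite zvA.
Qed.

End Ladders.

(** The numerical inequality that dictates the denominator of [eta] in [small_expansion]. *)
Lemma sqr_le_mul_exp n : (0 < n)%N -> (n.+1 ^ 2 <= n * 2 ^ (n + 3))%N.
Proof.
rewrite expnD; have := ltn_expl n (isT : (1 < 2)%N).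
move: (2 ^ n)%N => p; nia.
Qed.

(** * Expansion of small locally minimal cochains *)

Section SmallExpansion.
Variables (R : realType) (T : finType) (d : nat) (X : {set {set T}}) (F : augSheaf X).
Hypothesis HX : is_dcomplex d X.
Implicit Types (x y z : {set T}).
Local Notation w := (weight R d X).

Lemma differential_eq0 (f : cochain F) y s :
  (forall v, v \in y -> forall t, f (y :\ v) t = 0) -> differential f y s = 0.
Proof.
move=> f0; rewrite /differential; case: ifP => // /andP[yX yo].
rewrite big1 // => i _; rewrite f0 ?raddf0 ?mul0rz //.
by rewrite -(ordering_mem yo) mem_tnth.
Qed.

Lemma differential_eq (f g : cochain F) y s :
  (forall v, v \in y -> forall t, f (y :\ v) t = g (y :\ v) t) ->
  differential f y s = differential g y s.
Proof.
move=> fg; rewrite /differential; case: ifP => // /andP[yX yo].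
apply: eq_bigr => i _; rewrite fg //.
by rewrite -(ordering_mem yo) mem_tnth.
Qed.

(* Every face of the support of [f] is assigned the end of one of its ladders.
   In a good face [y] all facets from the support get the same end [z], so that
   there [df] agrees with the differential of the part of [f] assigned to [z]. *)
Lemma small_expansion n (f : cochain F) (e lambda : R) :
  (0 < n)%N -> (n <= d)%N -> 0 <= e -> 0 <= lambda ->
  let eta := e / (n%:R ^+ 2 * 2 ^+ (2 * n + 4)) in
  lambda <= eta ^+ (2 ^ n.-1) ->
  (forall z, z \in X -> (#|z| < n)%N -> spectral_gap (link_graph R d X z) lambda) ->
  (forall x, x \in cells X n -> nonzero_group (F x)) ->
  (forall x, x \in cells X n.+1 -> nonzero_group (F x)) ->
  (forall z, z \in X -> (0 < #|z|)%N -> (#|z| <= n)%N ->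
     coboundary_expander (d - #|z|) (link_sheaf F z) (n - #|z|) (e * (n.+1 - #|z|)%:R / n.+1%:R)) ->
  is_cochain n f -> locally_minimal R d n f -> norm R d n f < eta ^+ (2 ^ n - 1) ->
  e / 2 * norm R d n f <= norm R d n.+1 (differential f).
Proof.
move=> n0 nd e0 l0 eta leta gap Fn Fn1 loc cf fmin small.
pose S := Defs.support n f.
have SX : S \subset cells X n by apply/subsetP => x /support_cells.
have nR : 0 < n%:R :> R by rewrite ltr0n.
have eta0 : 0 <= eta.
  by apply: divr_ge0 => //; apply: mulr_ge0; apply: exprn_ge0.
pose A := fat d X n S eta.
pose bad := bad_faces d X n S eta.
have bad_le := bad_faces_weight HX SX eta0 n0 nd l0 leta gap.
have A0 := set0_notin_fat HX SX eta0 small.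
have AX x : x \in A -> x \in X by exact: fat_face.
have SA x : x \in S -> x \in A by rewrite -(fat_top d eta SX) => /andP[].
have Scard x : x \in S -> #|x| = n by move=> /(subsetP SX)/cells_card.
have good y : y \in cells X n.+1 -> y \notin bad -> good_face A y.
  move=> yn ybad u v v' vv' vu v'u sub vA v'A; apply: contraNT ybad => uA.
  rewrite in_set yn; apply/existsP; exists u; apply/exists_inP; exists v; first by rewrite inE vu.
  by apply/exists_inP; exists v'; [rewrite inE v'u | rewrite vv' sub].
pose L z := [set x in S | root_face A x == z].
pose D z := Defs.support n.+1 (differential (restr (L z) f)).
have cD z : is_cochain n.+1 (differential (restr (L z) f)).
  by apply: cochain_differential; apply: restr_cochain.
(* If [L z] is nonempty, then [z] is fat, hence not the empty face, and the expansion of its link is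
   available. *)
have step1 z : e * set_weight R d X (L z) <= \sum_(y in D z) w y.
  have [L0|[x]] := set_0Vmem (L z).
    by rewrite L0 /set_weight big_set0 mulr0 sumr_ge0 // => y _; apply: weight_ge0.
  rewrite inE => /andP[xS /eqP xz].
  have [zA zx] := root_faceP (SA x xS); rewrite xz in zA zx.
  have z0 : (0 < #|z|)%N.
    by rewrite lt0n cards_eq0; apply: contraNneq A0 => <-.
  have zn : (#|z| <= n)%N by rewrite (fat_card zA).
  apply: (local_expansion HX nd (AX z zA) z0 zn cf fmin) => //.
  - by apply/subsetP => t; rewrite inE => /andP[].
  - move=> t; rewrite inE => /andP[tS /eqP <-].
    by have [] := root_faceP (SA t tS).
  - exact: loc (AX z zA) z0 zn.
have facet y z : y \in D z -> exists2 v, v \in y & y :\ v \in L z.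
  move=> yD; apply/exists_inP; apply: contraTT yD; rewrite negb_exists_in => /forall_inP none.
  rewrite in_set differential_eq0 ?eqxx ?andbF // => v vy t.
  by rewrite /restr (negPf (none v vy)).
(* Off the bad faces at most one piece contributes, and there its differential is that of [f]; on a
   bad face the [n + 1] facets belong to at most [n + 1] pieces. *)
have count y : y \in cells X n.+1 ->
    (#|[set z | y \in D z]| <= (y \in Defs.support n.+1 (differential f)) + n.+1 * (y \in bad))%N.
  move=> yn; have yc := cells_card yn.
  have sub : [set z | y \in D z] \subset [set root_face A (y :\ v) | v in y].
    apply/subsetP => z; rewrite inE => /facet[v vy]; rewrite inE => /andP[_ /eqP <-].
    exact: imset_f.
  case: (boolP (y \in bad)) => [_|/(good y yn) gy].
    rewrite muln1; apply: leq_trans (leq_addl _ _).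
    by rewrite -yc; apply: leq_trans (subset_leq_card sub) (leq_imset_card _ _).
  rewrite muln0 addn0.
  have [->|[z0]] := set_0Vmem [set z | y \in D z]; first by rewrite cards0.
  rewrite inE => yz0.
  have uniq_root z x : y \in D z -> x \in S -> x \subset y -> root_face A x = z.
    move=> /facet[v vy]; rewrite inE => /andP[vS /eqP <-] xS xy.
    apply: (good_root gy) => //; try exact: SA.
    - exact: subD1set.
    - by rewrite !Scard.
    - by rewrite yc Scard.
  have -> : y \in Defs.support n.+1 (differential f).
    move: yz0; rewrite !in_set => /andP[-> H] /=.
    suff -> : differential f y (enum y) = differential (restr (L z0) f) y (enum y) by [].
    apply: differential_eq => v vy t; rewrite /restr; case: ifP => // nL.
    apply/eqP; apply: contraFT nL => fn.
    have [vn vo] := cochain_supp cf fn.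
    have vS : y :\ v \in S by rewrite (mem_support cf vo).
    rewrite inE vS /=; apply/eqP; apply: uniq_root vS (subD1set _ _).
    by rewrite in_set yn.
  have [v vy vL] := facet _ _ yz0.
  apply: (@leq_trans #|[set z0]|); last by rewrite cards1.
  apply: subset_leq_card; apply/subsetP => z; rewrite in_set in_set1 => yz.
  move: vL; rewrite inE => /andP[vS _].
  by rewrite -(uniq_root z _ yz vS (subD1set _ _)) (uniq_root z0 _ yz0 vS (subD1set _ _)).
have sumL : norm R d n f = \sum_z set_weight R d X (L z).
  rewrite /norm /set_weight (partition_big (root_face A) xpredT) //=.
  by apply: eq_bigr => z _; apply: eq_bigl => x; rewrite [RHS]in_set.
have main : e * norm R d n f <= norm R d n.+1 (differential f) + n.+1%:R * set_weight R d X bad.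
  rewrite sumL mulr_sumr; apply: le_trans (ler_sum _ (fun z _ => step1 z)) _.
  rewrite (exchange_big_dep (mem (cells X n.+1))) /=; last by move=> z y _ /support_cells.
  apply: (@le_trans _ _ (\sum_(y in cells X n.+1)
     ((y \in Defs.support n.+1 (differential f))%:R + n.+1%:R * (y \in bad)%:R) * w y)).
    apply: ler_sum => y yn; rewrite sumr_const -[leLHS]mulr_natl.
    apply: ler_wpM2r; first exact: weight_ge0.
    rewrite -natrM -natrD ler_nat; apply: leq_trans (count y yn).
    by apply: subset_leq_card; apply/subsetP => z; rewrite inE.
  under eq_bigr do rewrite mulrDl.
  rewrite big_split /=; apply: lerD.
    rewrite /norm /set_weight [leRHS]big_mkcond [leLHS]big_mkcond /=; apply: ler_sum => y _.
    case: ifP => [yn|_]; case: ifP => // _; rewrite ?mul1r ?mul0r //; exact: weight_ge0.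
  rewrite /set_weight mulr_sumr [leRHS]big_mkcond [leLHS]big_mkcond /=; apply: ler_sum => y _.
  case: ifP => [yn|_]; case: ifP => // _; rewrite ?mulr1 ?mulr0 ?mul0r //.
  by rewrite mulr_ge0 ?weight_ge0.
have nf0 : 0 <= norm R d n f by apply: norm_ge0.
suff : n.+1%:R * set_weight R d X bad <= e / 2 * norm R d n f by lra.
apply: le_trans (ler_wpM2l (ler0n _ _) bad_le) _.
rewrite -[set_weight R d X S]/(norm R d n f) [leLHS]mulrA; apply: ler_wpM2r => //.
(* The loss has coefficient [(n + 1)^2 n 2^n eta]. With the value of [eta], comparing it to [e / 2]
   amounts to this inequality. *)
have num : n.+1%:R ^+ 2 <= n%:R * 2 ^+ (n + 3) :> R.
  by rewrite -!natrX -natrM ler_nat sqr_le_mul_exp.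
rewrite /eta !mulrA ler_pdivrMr; last by rewrite mulr_gt0 ?exprn_gt0.
have E : 2 ^+ (2 * n + 4) = 2 ^+ n.-1 * 2 ^+ (n + 3) * 2 ^+ 2 :> R.
  by rewrite -!exprD -addnA; congr (_ ^+ _); case: (n) n0 => // m _; rewrite mulSn; ring.
rewrite E; have : 0 <= 2 ^+ n.-1 :> R by rewrite exprn_ge0.
move: num nR; move: (n.+1%:R : R) (n%:R : R) (2 ^+ (n + 3) : R) (2 ^+ n.-1 : R) => a b c g num b0 g0.
have : 0 <= (2 * b * g * e) * (b * c - a ^+ 2).
  by apply: mulr_ge0; [rewrite !mulr_ge0 // ltW | lra].
lra.
Qed.

End SmallExpansion.

(** * Cosystolic expansion *)

Section Correction.
Variables (R : realType) (T : finType) (d : nat) (X : {set {set T}}) (F : augSheaf X).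
Hypothesis HX : is_dcomplex d X.
Implicit Types (x y z : {set T}) (f g h : cochain F).
Local Notation w := (weight R d X).

Definition zero_cochain : cochain F := fun _ _ => 0.

Definition cochain_opp f : cochain F := fun x s => - f x s.

Lemma cochain0 n : is_cochain n zero_cochain.
Proof. by split=> // x t p; rewrite mul0rz. Qed.

Lemma cochainN n f : is_cochain n f -> is_cochain n (cochain_opp f).
Proof.
move=> [f0 fa]; split=> [x s xs|x t p]; rewrite /cochain_opp; first by rewrite f0 ?oppr0.
by rewrite fa mulNrz.
Qed.

Lemma cochain_addA f g h : cochain_add f (cochain_add g h) = cochain_add (cochain_add f g) h.
Proof. by apply: cochain_ext => x s; apply: addrA. Qed.

Lemma cochain_add0 f : cochain_add f zero_cochain = f.
Proof. by apply: cochain_ext => x s; apply: addr0. Qed.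

Lemma differential0 : differential zero_cochain = zero_cochain.
Proof. by apply: cochain_ext => y s; apply: differential_eq0. Qed.

Lemma differentialD f g :
  differential (cochain_add f g) = cochain_add (differential f) (differential g).
Proof.
apply: cochain_ext => y s; rewrite /cochain_add /differential.
case: ifP => _; last by rewrite addr0.
by rewrite -big_split; apply: eq_bigr => i _; rewrite raddfD mulrzDl.
Qed.

Lemma differentialN f : differential (cochain_opp f) = cochain_opp (differential f).
Proof.
apply: cochain_ext => y s; rewrite /cochain_opp /differential.
case: ifP => _; last by rewrite oppr0.
by rewrite -sumrN; apply: eq_bigr => i _; rewrite raddfN mulNrz.
Qed.

Lemma normN n f : norm R d n (cochain_opp f) = norm R d n f.
Proof. by apply: eq_bigl => x; rewrite !in_set /cochain_opp oppr_eq0. Qed.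

Lemma norm0 n : norm R d n zero_cochain = 0.
Proof. by apply: big1 => x; rewrite in_set eqxx andbF. Qed.

Lemma norm_eq0 n f : is_cochain n f -> norm R d n f <= 0 -> f = zero_cochain.
Proof.
move=> cf f0; apply: cochain_ext => x s; apply/eqP; apply: contraTT f0 => fx.
have [xn xs] := cochain_supp cf fx; rewrite -ltNge /norm /set_weight.
rewrite (bigD1 x) /=; last by rewrite (mem_support cf xs).
by apply: ltr_pwDl; [exact: (weight_gt0 R HX (cells_face xn)) | apply: sumr_ge0 => y _; apply: weight_ge0].
Qed.

Lemma normD_le n f g : norm R d n (cochain_add f g) <= norm R d n f + norm R d n g.
Proof.
apply: le_trans (set_weightU _ _ _ _ _); apply: set_weight_le.
apply/subsetP => x; rewrite in_setU !mem_supportE /cochain_add.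
case: (x \in cells X n) => //=; apply: contraTT; rewrite negb_or !negbK => /andP[/eqP-> /eqP->].
by rewrite addr0.
Qed.

(** The groups may be infinite, but the norm depends only on the support, and there are finitely
    many supports. *)
Lemma minimizer_exists n (B : cochain F -> Prop) f b0 : B b0 ->
  exists b, minimizer R d n B f b.
Proof.
move=> Bb0; pose P := [pred A : {set {set T}} | `[< exists2 b, B b & Defs.support n (cochain_add f b) = A >]].
have P0 : P (Defs.support n (cochain_add f b0)) by apply/asboolP; exists b0.
case: (arg_minP (set_weight R d X) P0) => A /asboolP[b Bb bA] Amin.
exists b; split=> // b' Bb'; rewrite /norm bA; apply: Amin.
by apply/asboolP; exists b'.
Qed.

(** The norm cleared of its denominator: a natural number that drops at each correction step, which
    makes the process terminate. *)
Definition support_count n f : nat := (\sum_(y in Defs.support n f) #|facets_over d X y|)%N.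

Lemma norm_count n f :
  norm R d n f = (support_count n f)%:R / ('C(d.+1, n)%:R * #|cells X d.+1|%:R).
Proof.
rewrite /norm /set_weight /support_count natr_sum mulr_suml; apply: eq_bigr => y /support_cells yn.
by rewrite weightE (cells_card yn).
Qed.

Lemma weight_vertex Q v : (max_degree d X <= Q)%N ->
  w [set v] <= Q%:R / (d.+1%:R * #|cells X d.+1|%:R).
Proof.
move=> degQ; have M0 := card_facets_gt0 HX.
have [vX|vX] := boolP ([set v] \in X); last first.
  by rewrite (weight_eq0 R HX vX) divr_ge0 // mulr_ge0.
rewrite weightE cards1 bin1; apply: ler_wpM2r; first by rewrite invr_ge0 mulr_ge0.
rewrite ler_nat; apply: leq_trans degQ.
rewrite /max_degree (bigD1 v) //=; apply: leq_trans (leq_maxl _ _).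
by apply: subset_leq_card; apply/subsetP => y; rewrite !inE sub1set.
Qed.

Lemma norm_off_vertex n v f : (n <= d.+1)%N -> (0 < n)%N ->
  (forall y t, ~~ (v \in y) -> f y t = 0) -> norm R d n f <= n%:R * w [set v].
Proof.
move=> nd n0 foff; rewrite -[n in n%:R]bin1 -(cards1 v) -(sum_weight_over R HX) ?cards1 //.
rewrite /norm /set_weight [leLHS]big_mkcond [leRHS]big_mkcond /=; apply: ler_sum => y _.
rewrite in_set sub1set; case: (boolP (y \in cells X n)) => //= yn.
have [vy|vy] := boolP (v \in y); last by rewrite foff // eqxx.
by case: ifP => // _; apply: weight_ge0.
Qed.

(** An improving correction is some [d(g^z)] with [z] nonempty. Any vertex [v] of [z] will do, since
    [g^z] vanishes off the faces containing [z]; the degree bound then limits the cost. *)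
Lemma not_locally_minimal n g : is_cochain n.+1 g -> ~ locally_minimal R d n.+1 g ->
  exists h v, [/\ is_cochain n h, forall y t, ~~ (v \in y) -> h y t = 0
    & norm R d n.+1 (cochain_add g (differential h)) < norm R d n.+1 g].
Proof.
move=> cg nmin; apply: contrapT => none; apply: nmin => z s zX zn zs g' h cg' hext.
rewrite leNgt; apply/negP => lt_norm; apply: none.
have [ch _ hoff] := hext; case/andP: zn => /card_gt0P[v vz] zn.
exists h, v; split=> //; first by move: ch; rewrite subnK.
by move=> y t vy; apply: hoff; apply: contraNN vy => /subsetP; apply.
Qed.

(* Each correction step lowers the norm of g by at least the weight unit
   1 / ('C(d+1, n+1) |X(d)|), and costs a cochain supported on the faces
   containing a given vertex. *)
Lemma locally_minimal_correction n Q g : (0 < n)%N -> (n <= d)%N -> (max_degree d X <= Q)%N ->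
  is_cochain n.+1 g ->
  exists h, [/\ is_cochain n h, locally_minimal R d n.+1 (cochain_add g (differential h))
    & norm R d n h <= n%:R * Q%:R / d.+1%:R * 'C(d.+1, n.+1)%:R
        * (norm R d n.+1 g - norm R d n.+1 (cochain_add g (differential h)))].
Proof.
move=> n0 nd degQ; set C := _ * 'C(_, _)%:R.
have C0 : 0 <= C by rewrite mulr_ge0 // divr_ge0 // mulr_ge0.
have [m] := ubnP (support_count n.+1 g); elim: m g => // m IH g; rewrite ltnS => gm cg.
have [gmin|/(not_locally_minimal cg)[h [v [ch hoff hlt]]]] := pselect (locally_minimal R d n.+1 g).
  exists zero_cochain; rewrite differential0 cochain_add0; split=> //; first exact: cochain0.
  by rewrite norm0 subrr mulr0.
have cdh := cochain_differential ch.
set g1 := cochain_add g (differential h) in hlt *.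
have M0 : 0 < #|cells X d.+1|%:R :> R by rewrite ltr0n card_facets_gt0.
have B0 : 0 < 'C(d.+1, n.+1)%:R :> R by rewrite ltr0n bin_gt0.
have cnt : (support_count n.+1 g1 < support_count n.+1 g)%N.
  by move: hlt; rewrite !norm_count ltr_pM2r ?invr_gt0 ?mulr_gt0 // ltr_nat.
have [h1 [ch1 min1 le1]] := IH g1 (leq_trans cnt gm) (cochainD cg cdh).
exists (cochain_add h h1); rewrite differentialD cochain_addA -/g1; split=> //.
  exact: cochainD.
apply: le_trans (normD_le _ _ _) _.
have -> : norm R d n.+1 g - norm R d n.+1 (cochain_add g1 (differential h1))
  = (norm R d n.+1 g - norm R d n.+1 g1)
    + (norm R d n.+1 g1 - norm R d n.+1 (cochain_add g1 (differential h1))) by ring.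
rewrite mulrDr; apply: lerD => //.
apply: le_trans (norm_off_vertex (leqW nd) n0 hoff) _.
apply: le_trans (ler_wpM2l (ler0n _ _) (weight_vertex v degQ)) _.
have unit_le : ('C(d.+1, n.+1)%:R * #|cells X d.+1|%:R)^-1 <= norm R d n.+1 g - norm R d n.+1 g1.
  rewrite !norm_count -mulrBl -[leLHS]mul1r ler_wpM2r ?invr_ge0 ?mulr_ge0 //.
  by rewrite lerBrDr nat1r ler_nat.
apply: le_trans (ler_wpM2l C0 unit_le).
have D0 : 0 < d.+1%:R :> R by rewrite ltr0n.
(* [C] is the cost [n Q / ((d + 1) |X(d)|)] of one step divided by the weight unit, so equality
   holds. *)
rewrite le_eqVlt; apply/orP; left; apply/eqP; rewrite /C.
move: M0 B0 D0; move: (#|_|%:R : R) ('C(_, _)%:R : R) (d.+1%:R : R) => a b c a0 b0 c0.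
by field; rewrite !gt_eqF.
Qed.

End Correction.

Section Cosystolic.
Variables (R : realType) (T : finType) (d : nat) (X : {set {set T}}) (F : augSheaf X).
Hypothesis HX : is_dcomplex d X.
Implicit Types (f b : cochain F).

(** Both halves rest on the fact that a small locally minimal cocycle is 0. Positivity of [beta] is
    asked only if [alpha > 0], because the constants of the theorem may vanish; then the radius is 0
    and no cochain has smaller norm. *)
Lemma expands_small_cosystolic n Q (beta alpha beta' alpha' : R) :
  (n < d)%N -> (0 < Q)%N -> (max_degree d X <= Q)%N ->
  (forall x, x \in cells X n.+1 -> nonzero_group (F x)) ->
  (forall x, x \in cells X n.+2 -> nonzero_group (F x)) ->
  0 <= alpha' -> (0 < alpha -> 0 < beta) -> (0 < alpha' -> 0 < beta') ->
  expands_small d F n.+1 beta alpha -> expands_small d F n.+2 beta' alpha' ->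
  cosystolic_expander d F n.+1
    (Num.min alpha' (d.+1%:R / (n.+1%:R * Q%:R) * ('C(d.+1, n.+2)%:R)^-1)) alpha.
Proof.
move=> nd Q0 degQ Fn Fn1 a0 ab ab' small small'; split=> [f cf|f [cf df0] nb].
  set e := Num.min _ _.
  have B0 : 0 < 'C(d.+1, n.+2)%:R :> R by rewrite ltr0n bin_gt0.
  have e0 : 0 <= e by rewrite le_min a0 mulr_ge0 ?invr_ge0 // divr_ge0 // mulr_ge0.
  have z0 : is_cocycle n.+1 (@zero_cochain _ _ F).
    by split; [exact: cochain0 | rewrite differential0].
  have [b bmin] := minimizer_exists R d n.+1 f z0.
  exists b => //; have [_ ble] := bmin.
  rewrite !(mass_eq1 R HX) ?mulr1 //; last exact: leqW nd.
  (* For large [df] the bound is trivial: the minimum over cocycles is at most the norm of [f],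
     hence at most 1. *)
  have [big|df] := leP alpha' (norm R d n.+2 (differential f)).
    apply: le_trans big; apply: le_trans (_ : e <= _); last by rewrite ge_min lexx.
    apply: ler_piMr => //; apply: le_trans (ble _ z0) _.
    by rewrite cochain_add0; apply: (norm_le1 R HX); apply: leqW nd.
  have cdf := cochain_differential cf.
  have [h [ch hmin hle]] := locally_minimal_correction R HX (isT : (0 < n.+1)%N) nd degQ cdf.
  set g := cochain_add _ _ in hmin hle.
  have gE : g = differential (cochain_add f h) by rewrite differentialD.
  have g_le : norm R d n.+2 g <= norm R d n.+2 (differential f).
    have C0 : 0 < n.+1%:R * Q%:R / d.+1%:R * 'C(d.+1, n.+2)%:R :> R.
      by rewrite mulr_gt0 // divr_gt0 ?mulr_gt0 ?ltr0n.
    rewrite -subr_ge0; move: (le_trans (norm_ge0 _ _ _ _) hle).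
    by rewrite pmulr_rge0.
  have cg : is_cochain n.+2 g by rewrite gE; apply: cochain_differential; apply: cochainD.
  have := small' g cg hmin (le_lt_trans g_le df).
  have -> : differential g = @zero_cochain _ _ F.
    by rewrite gE; apply: cochain_ext => y s; apply: (differential_differential HX).
  rewrite norm0 pmulr_rle0 ?ab' ?(le_lt_trans (norm_ge0 _ _ _ _) df) // => /(norm_eq0 HX cg) g0.
  (* As [g = d(f + h)] is 0, subtracting [f + h] from [f] is allowed in the minimum and leaves [-h],
     whose norm is bounded by the cost of the correction. *)
  have zc : is_cocycle n.+1 (cochain_opp (cochain_add f h)).
    split; first exact/cochainN/cochainD.
    by move=> y s; rewrite differentialN -gE g0 /cochain_opp oppr0.
  have -> : norm R d n.+2 (differential f) = norm R d n.+2 (differential f) - norm R d n.+2 g.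
    by rewrite g0 norm0 subr0.
  apply: le_trans (ler_wpM2l e0 (ble _ zc)) _.
  have -> : cochain_add f (cochain_opp (cochain_add f h)) = cochain_opp h.
    by apply: cochain_ext => x s; rewrite /cochain_add /cochain_opp opprD addNKr.
  rewrite normN; apply: le_trans (ler_wpM2l e0 hle) _.
  rewrite mulrA; apply: ler_piMl; first by rewrite subr_ge0.
  apply: (@le_trans _ _ (d.+1%:R / (n.+1%:R * Q%:R) * ('C(d.+1, n.+2)%:R)^-1 *
     (n.+1%:R * Q%:R / d.+1%:R * 'C(d.+1, n.+2)%:R))).
    apply: ler_wpM2r; last by rewrite ge_min lexx orbT.
    by rewrite mulr_ge0 // divr_ge0 // mulr_ge0.
  have D0 : 0 < d.+1%:R :> R by rewrite ltr0n.
  have N0 : 0 < n.+1%:R :> R by rewrite ltr0n.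
  have QR0 : 0 < Q%:R :> R by rewrite ltr0n.
  move: B0 D0 N0 QR0; move: ('C(_, _)%:R : R) (d.+1%:R : R) (n.+1%:R : R) (Q%:R : R).
  move=> p q r t p0 q0 r0 t0; rewrite le_eqVlt; apply/orP; left; apply/eqP.
  by field; rewrite !gt_eqF.
rewrite (mass_eq1 R HX) ?mulr1 //; last exact: leqW nd.
have zb : is_coboundary n.+1 (@zero_cochain _ _ F).
  by exists (@zero_cochain _ _ F); [exact: cochain0 | rewrite differential0].
have [b [[g cg /cochain_ext bE] ble]] := minimizer_exists R d n.+1 f zb.
rewrite leNgt; apply/negP => fsmall.
have cb : is_cochain n.+1 b by rewrite bE; apply: cochain_differential.
have cfb := cochainD cf cb.
have fb_small : norm R d n.+1 (cochain_add f b) < alpha.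
  by apply: le_lt_trans (ble _ zb) _; rewrite cochain_add0.
(* The corrections [d(g^z)] are coboundaries, so a minimum over all coboundaries is locally
   minimal. *)
have fbmin : locally_minimal R d n.+1 (cochain_add f b).
  move=> z s zX /andP[z0 zn] zs g' h cg' [ch _ _]; rewrite -cochain_addA; apply: ble.
  exists (cochain_add g h); last by rewrite differentialD bE.
  by apply: cochainD => //; move: ch; rewrite /= subnK.
have := small _ cfb fbmin fb_small.
have -> : differential (cochain_add f b) = @zero_cochain _ _ F.
  rewrite differentialD (cochain_ext df0) bE; apply: cochain_ext => y s.
  by rewrite /cochain_add add0r (differential_differential HX).
rewrite norm0 pmulr_rle0 ?ab ?(le_lt_trans (norm_ge0 _ _ _ _) fb_small) //.
move=> /(norm_eq0 HX cfb) fb0; apply: nb; exists (cochain_opp g); first exact: cochainN.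
move=> x s; rewrite differentialN -bE /cochain_opp.
have := congr1 (fun h : cochain F => h x s) fb0; rewrite /cochain_add /zero_cochain => /eqP.
by rewrite addr_eq0 => /eqP.
Qed.

End Cosystolic.

(** * The constants of the theorem *)

Lemma ord_min_le (R : realType) n (e : 'I_n.+1 -> R) i : ord_min e <= e i.
Proof. exact: bigmin_le. Qed.

Lemma ord_min_ge0 (R : realType) n (e : 'I_n.+1 -> R) :
  (forall i, 0 <= e i) -> 0 <= ord_min e.
Proof.
move=> e0; rewrite /ord_min.
by elim/big_ind: _ => // x y x0 y0; rewrite le_min x0.
Qed.

Lemma coboundary_expander_le (R : realType) (T : finType) d (X : {set {set T}})
    (F : augSheaf X) n (e e' : R) : e' <= e ->
  coboundary_expander d F n e -> coboundary_expander d F n e'.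
Proof.
move=> ee exp f cf; have [b bmin le] := exp f cf; exists b => //.
by apply: le_trans le; do 2 (apply: ler_wpM2r; first exact: set_weight_ge0).
Qed.

(** Conclusions (i) and (ii) are the instances [k] and [k + 1]. The spectral parameter is the
    trickled bound [d * lambda], and [e] is the largest number with
    [e * (k + 1 - i) / (k + 2) <= e_ i] for all [i], the expansion that [small_expansion] asks of
    the links. *)
Lemma local_small_expansion (R : realType) (T : finType) (d k : nat) (X : {set {set T}})
    (F : augSheaf X) (e_ : 'I_k.+1 -> R) (lambda : R) :
  let e := ord_min (fun i : 'I_k.+1 => k.+2%:R * e_ i / (k.+1 - i)%:R) in
  let c := e / (k.+1%:R ^+ 2 * 2 ^+ (2 * k + 6)) in
  is_dcomplex d X -> strongly_connected d X -> (2 <= d)%N -> (k < d)%N ->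
  (forall i, 0 <= e_ i) -> 0 <= lambda -> lambda <= d%:R^-1 ->
  d%:R * lambda <= c ^+ (2 ^ k) ->
  local_spectral_expander d X (d - 2) lambda ->
  (forall i : 'I_k.+1, local_coboundary_expander d F i k.+1 (e_ i)) ->
  (forall x, x \in cells X k.+1 -> nonzero_group (F x)) ->
  (forall x, x \in cells X k.+2 -> nonzero_group (F x)) ->
  expands_small d F k.+1 (e / 2) (c ^+ (2 ^ k.+1 - 1)).
Proof.
move=> e c HX scX d2 kd e0 l0 ld lc spec loc Fn Fn1 f cf fmin small.
have ee0 : 0 <= e by apply: ord_min_ge0 => i; rewrite divr_ge0 // mulr_ge0.
have E : (2 * k + 6 = 2 * k.+1 + 4)%N by lia.
rewrite /c E in lc small.
apply: (small_expansion HX (n := k.+1) (lambda := d%:R * lambda)) => //.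
- by rewrite mulr_ge0.
- move=> z zX zk; apply: link_graph_gap => //; exact: leq_trans zk kd.
- move=> z zX z0 zk.
  have ik : (#|z|.-1 < k.+1)%N by rewrite prednK.
  have := loc (Ordinal ik) z; rewrite /= prednK // inE zX eqxx => /(_ isT).
  apply: coboundary_expander_le.
  have := ord_min_le (fun i : 'I_k.+1 => k.+2%:R * e_ i / (k.+1 - i)%:R) (Ordinal ik).
  rewrite -/e /= (_ : k.+1 - #|z|.-1 = k.+2 - #|z|)%N; last by lia.
  have p1 : 0 < (k.+2 - #|z|)%:R :> R by rewrite ltr0n subn_gt0.
  have p2 : 0 < k.+2%:R :> R by rewrite ltr0n.
  by rewrite ler_pdivlMr // ler_pdivrMr // [_ * e_ _]mulrC.
Qed.

Theorem theorem8p1 (R : realType) (k Q : nat)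
    (eps_ : 'I_k.+1 -> R) (eps'_ : 'I_k.+2 -> R) (lambda : R)
    (T : finType) (d : nat) (X : {set {set T}}) (F : augSheaf X) :
  let eps := ord_min (fun i : 'I_k.+1 => k.+2%:R * eps_ i / (k.+1 - i)%:R) in
  let eps' := ord_min (fun i : 'I_k.+2 => k.+3%:R * eps'_ i / (k.+2 - i)%:R) in
  let c := eps / (k.+1%:R ^+ 2 * 2 ^+ (2 * k + 6)) in
  let c' := eps' / (k.+2%:R ^+ 2 * 2 ^+ (2 * k + 8)) in
  (0 < Q)%N ->
  (forall i, 0 <= eps_ i) -> (forall i, 0 <= eps'_ i) -> 0 <= lambda ->
  lambda <= d%:R^-1 *
    Num.min (c ^+ (2 ^ k)) (Num.min (c' ^+ (2 ^ k.+1)) 1) ->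
  is_dcomplex d X -> strongly_connected d X -> is_sheaf F ->
  (k + 2 <= d)%N ->
  (forall i : 'I_k.+1, local_coboundary_expander d F i k.+1 (eps_ i)) ->
  (forall i : 'I_k.+2, local_coboundary_expander d F i k.+2 (eps'_ i)) ->
  local_spectral_expander d X (d - 2) lambda ->
  (max_degree d X <= Q)%N ->
  (forall x : {set T},
     x \in cells X k.+1 :|: cells X k.+2 :|: cells X k.+3 ->
     nonzero_group (F x)) ->
  [/\ expands_small d F k.+1 (eps / 2) (c ^+ (2 ^ k.+1 - 1)),
      expands_small d F k.+2 (eps' / 2) (c' ^+ (2 ^ k.+2 - 1))
    & cosystolic_expander d F k.+1
        (Num.min (c' ^+ (2 ^ k.+2 - 1))
           (d.+1%:R / (k.+1%:R * Q%:R) * ('C(d.+1, k.+2)%:R)^-1))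
        (c ^+ (2 ^ k.+1 - 1))].
Proof.
move=> eps eps' c c' Q0 e0 e'0 l0 lam HX scX _ kd loc loc' spec degQ Fn.
have d0 : 0 < d%:R :> R by rewrite ltr0n; lia.
have F1 x : x \in cells X k.+1 -> nonzero_group (F x).
  by move=> xk; apply: Fn; rewrite !in_setU xk.
have F2 x : x \in cells X k.+2 -> nonzero_group (F x).
  by move=> xk; apply: Fn; rewrite !in_setU xk orbT.
have F3 x : x \in cells X k.+3 -> nonzero_group (F x).
  by move=> xk; apply: Fn; rewrite !in_setU xk orbT.
have lamE (t : R) : Num.min (c ^+ (2 ^ k)) (Num.min (c' ^+ (2 ^ k.+1)) 1) <= t -> d%:R * lambda <= t.
  move=> mt; apply: le_trans mt; apply: le_trans (ler_wpM2l (ltW d0) lam) _.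
  by rewrite mulVKf ?gt_eqF.
have ld : lambda <= d%:R^-1.
  rewrite -[leRHS]mulr1 mulrC -ler_pdivrMr ?invr_gt0 // invrK mulrC; apply: lamE.
  by rewrite !ge_min lexx !orbT.
have d2 : (2 <= d)%N by lia.
have kd1 : (k < d)%N by lia.
have kd2 : (k.+1 < d)%N by lia.
have E : (2 * k + 8 = 2 * k.+1 + 6)%N by lia.
have small : expands_small d F k.+1 (eps / 2) (c ^+ (2 ^ k.+1 - 1)).
  apply: (local_small_expansion (lambda := lambda)) => //.
  by apply: lamE; rewrite ge_min lexx.
have small' : expands_small d F k.+2 (eps' / 2) (c' ^+ (2 ^ k.+2 - 1)).
  rewrite /c' E; apply: (local_small_expansion (lambda := lambda)) => //.
  by rewrite -E; apply: lamE; rewrite !ge_min lexx orbT.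
split=> //.
(* A positive radius excludes [e = 0], because the radius is a power of [e / q] with positive
   exponent. *)
have pos (e : R) q m : (0 < m)%N -> 0 < q -> 0 <= e -> 0 < (e / q) ^+ m -> 0 < e / 2.
  move=> m0 q0 ege0; have [->|en0] := eqVneq e 0; last by rewrite divr_gt0 // lt_neqAle eq_sym en0.
  by rewrite mul0r expr0n gtn_eqF // ltxx.
have eps0 : 0 <= eps by apply: ord_min_ge0 => i; rewrite divr_ge0 // mulr_ge0.
have eps'0 : 0 <= eps' by apply: ord_min_ge0 => i; rewrite divr_ge0 // mulr_ge0.
have expS m : (0 < 2 ^ m.+1 - 1)%N by rewrite subn_gt0 -{1}(expn0 2) ltn_exp2l.
apply: expands_small_cosystolic small small' => //.
- by rewrite exprn_ge0 // divr_ge0 // mulr_ge0 ?exprn_ge0.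
- by apply: pos => //; rewrite mulr_gt0 ?exprn_gt0 ?ltr0n.
- by apply: pos => //; rewrite mulr_gt0 ?exprn_gt0 ?ltr0n.
Qed.
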